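(* Let $r,p,n,e$ be positive integers with $p\mid r$ and $e\mid p$. Let $G=G(r,p,n)$ act on $V=\mathbb{C}^n$, let $\gamma=\operatorname{diag}(\xi_{\frac{er}{p}},1,\ldots,1)$, let $\zeta$ be a primitive $m$-th root of unity, and let $d=\frac{m}{\gcd(m,r)}$. Then the following isomorphisms of posets hold: (i) If $d>1$, $n\equiv 0 \pmod d$ and $(\zeta^n\xi_{\frac{er}{p}}^{-1})^{\frac{r}{p}}\neq 1$, then $\mathcal{S}_\zeta^V(\gamma G)\cong Q_n(dr,d,d,\{0\})\setminus\{\hat 0\}$. (ii) If $d>1$ and the conditions of (i) are not satisfied, then $\mathcal{S}_\zeta^V(\gamma G)\cong Q_n(dr,d,d)\setminus\{\hat 0\}$. (iii) If $d=1$ and $(\zeta^n\xi_{\frac{er}{p}}^{-1})^{\frac{r}{p}}\neq 1$, then $\mathcal{S}_\zeta^V(\gamma G)\cong Q_n(r,\{0\})\setminus\{\hat 0\}$. (iv) If $d=1$, $r=p\neq 1$ and $\zeta^n=\xi_e$, then $\mathcal{S}_\zeta^V(\gamma G)\cong Q_n(r,\{1\})$. (v) If $d=1$ and $r=p=1$, then $m=1$ and $\mathcal{S}_\zeta^V(\gamma G)\cong Q_{n-1}(1)\cong \Pi_n$. (vi) If $d=1$ and the conditions of (iii), (iv) and (v) are not satisfied, then $\mathcal{S}_\zeta^V(\gamma G)\cong Q_n(r)$.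
   Context: Reflection groups and eigenspace posets. For each positive integer $s$, $\mu_s$ is the group of complex $s$-th roots of unity and $\xi_s$ is a fixed primitive $s$-th root of unity. For $p\mid r$, $G(r,p,n)$ is the group of all $n\times n$ monomial matrices (exactly one nonzero entry in each row and column) whose nonzero entries are complex $r$-th roots of unity with product an $\frac rp$-th root of unity. For $x\in GL(V)$, $V(x,\zeta)=\{v\in V\mid xv=\zeta v\}$. $\mathcal{S}_\zeta^V(\gamma G)$ is the set of subspaces $\{V(x,\zeta)\mid x\in\gamma G\}$, partially ordered by the reverse of inclusion. Dowling lattices. Write $[n]=\{1,\dots,n\}$, and identify $\mu_s$ with $\mathbb{Z}/s\mathbb{Z}$. A $\mu_s$-prepartition is a triple $(I,\pi,\lambda)$, where $I\subseteq[n]$ (the zero block, possibly empty), $\pi=B_1\mid\cdots\mid B_l$ is a partition of $[n]\setminus I$ into nonempty blocks (the nonzero blocks), and $\lambda:[n]\setminus I\to\mu_s$ is a map. Two prepartitions are equivalent if they have the same $I$ and the same $\pi$ and, for each block $B_i$, their labellings restricted to $B_i$ differ by multiplication by a constant of $\mu_s$ (depending on the block). The elements of $Q_n(s)$ are the equivalence classes. The partial order is generated by the covering relations: $\alpha$ is covered by $\beta$ if $\beta$ is obtained from $\alpha$ either by merging a nonzero block $B_i$ into the zero block ($I$ is replaced by $I\cup B_i$), or by merging two nonzero blocks $B_i,B_j$ into one block $B_i\cup B_j$ with labelling $\lambda$ on $B_i$ and $\lambda\cdot g$ on $B_j$ for some $g\in\mu_s$. The minimum $\hat 0$ of $Q_n(s)$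 has $I=\emptyset$ and all nonzero blocks singletons; the maximum $\hat 1$ has $I=[n]$. ($Q_0(s)$ is the one-element poset.) $\Pi_n$ is the lattice of partitions of an $n$-element set ordered by refinement. Subposets (with the induced order): - For $J\subseteq\{0,\dots,n\}$, $Q_n(s,J)$ consists of $\hat 0$ together with the elements whose zero block satisfies $|I|\notin J$. - For $k\mid s$ and $k\mid d$, $Q_n(s,d,k)$ consists of $\hat 0$ together with the elements all of whose nonzero blocks $B_i$ have size divisible by $d$ and are such that $|\{a\in B_i\mid \lambda(a)\equiv j \pmod k\}|$ is independent of $j$. - $Q_n(s,d,k,J)$ consists of $\hat 0$ together with the elements of $Q_n(s,d,k)$ with $|I|\notin J$. *)

(* Defs.v *)
From Stdlib Require Export Relation_Operators.
From HB Require Import structures.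
From mathcomp Require Export all_boot all_order all_algebra.
From mathcomp Require Export complex.
From mathcomp Require Export boolp classical_sets functions reals.

Set Implicit Arguments.
Unset Strict Implicit.
Unset Printing Implicit Defensive.

Import GRing.Theory.

Section PrePartitions.
Variables n s : nat.
Implicit Types (I B : {set 'I_n}) (P : {set {set 'I_n}}) (l : {ffun 'I_n -> 'I_s}).

(* [mu_s] is identified with Z/s, represented by ['I_s] with addition mod [s]
   (not by ['Z_s], which is Z/2 when [s = 1]).  The labelling is a total
   function; [prepart_equiv] ignores its values on the zero block, so that a
   class only depends on its restriction to the complement of [zero_block]. *)
Record prepart : predArgType := Prepart {
  prepart_val : {set 'I_n} * {set {set 'I_n}} * {ffun 'I_n -> 'I_s};
  _ : finset.partition prepart_val.1.2 (~: prepart_val.1.1)%SET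
}.
HB.instance Definition _ := [isSub for prepart_val].
HB.instance Definition _ := [Finite of prepart by <:].

Definition zero_block (x : prepart) : {set 'I_n} := (val x).1.1.
Definition nonzero_blocks (x : prepart) : {set {set 'I_n}} := (val x).1.2.
Definition label (x : prepart) : {ffun 'I_n -> 'I_s} := (val x).2.

Definition prepart_equiv : rel prepart := fun x y =>
  [&& zero_block x == zero_block y,
      nonzero_blocks x == nonzero_blocks y
    & [forall B in nonzero_blocks x, [exists g : 'I_s,
        [forall a in B, label y a == label x a + g %[mod s]]]]].

Lemma prepart_equivP x y : reflect
  [/\ zero_block x = zero_block y, nonzero_blocks x = nonzero_blocks y
    & forall B, B \in nonzero_blocks x -> exists g : nat,
        forall a, a \in B -> label y a = label x a + g %[mod s]]
  (prepart_equiv x y).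
Proof.
apply: (iffP and3P) => [[/eqP hI /eqP hP /forall_inP h]|[hI hP h]].
  split=> // B /h /existsP[g /forall_inP hg]; exists g => a /hg /eqP //.
split; try exact/eqP.
apply/forall_inP => B hB; have [g hg] := h B hB; apply/existsP.
have /and3P[_ _ B0] := valP x.
have /set0Pn[a0 _] : B != finset.set0.
  by apply: contraNneq B0 => <-.
have s0 : 0 < s by exact: leq_ltn_trans (ltn_ord (label x a0)).
exists (Ordinal (ltn_pmod g s0)); apply/forall_inP => a /hg -> /=.
by rewrite modnDmr.
Qed.

Lemma prepart_equiv_refl : reflexive prepart_equiv.
Proof.
by move=> x; apply/prepart_equivP; split=> // B _; exists 0 => a _; rewrite addn0.
Qed.

Lemma prepart_equiv_sym : symmetric prepart_equiv.
Proof.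
suff imp x y : prepart_equiv x y -> prepart_equiv y x.
  by move=> x y; apply/idP/idP; apply: imp.
move=> /prepart_equivP[hI hP h]; apply/prepart_equivP; split=> // B hB.
rewrite -hP in hB; have [g hg] := h B hB; exists (g * s.-1) => a aB.
have s0 : 0 < s by exact: leq_ltn_trans (ltn_ord (label x a)).
by rewrite -modnDml hg// modnDml -addnA -mulnS prednK// addnC modnMDl.
Qed.

Lemma prepart_equiv_trans : transitive prepart_equiv.
Proof.
move=> y x z /prepart_equivP[hI hP h] /prepart_equivP[hI' hP' h'].
apply/prepart_equivP; split; [by rewrite hI | by rewrite hP |] => B hB.
have [g hg] := h B hB; rewrite hP in hB; have [g' hg'] := h' B hB.
by exists (g + g') => a aB; rewrite hg'// -modnDml hg// modnDml addnA.
Qed.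

Canonical prepart_equivalence := EquivRel prepart_equiv
  prepart_equiv_refl prepart_equiv_sym prepart_equiv_trans.

End PrePartitions.

(* The elements of the Dowling lattice [Q_n(s)]. *)
Notation dowling n s := {eq_quot (prepart_equivalence n s)}%qT.

Local Open Scope classical_set_scope.

Section DowlingLattice.
Variables n s : nat.
Local Notation Q := (dowling n s).
Local Notation cls := (\pi_(dowling n s))%qT.
Implicit Types (x y : prepart n s) (q : Q).

Definition merge_zero x y : Prop := exists2 B, B \in nonzero_blocks x &
  [/\ zero_block y = (zero_block x :|: B)%SET,
      nonzero_blocks y = (nonzero_blocks x :\ B)%SET
    & label y = label x].

Definition merge_nonzero x y : Prop := exists B B' (g : nat),
  [/\ B \in nonzero_blocks x, B' \in nonzero_blocks x & B != B'] /\
  [/\ zero_block y = zero_block x,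
      nonzero_blocks y = ((B :|: B') |: (nonzero_blocks x :\ B :\ B'))%SET,
      forall a, a \notin B' -> label y a = label x a
    & forall a, a \in B' -> label y a = label x a + g %[mod s]].

Definition dowling_cover q q' : Prop := exists x y,
  [/\ cls x = q, cls y = q' & merge_zero x y \/ merge_nonzero x y].

Definition dowling_le : Q -> Q -> Prop := clos_refl_trans Q dowling_cover.

(* All labellings of singleton blocks are equivalent, so that for [0 < s] this
   set has exactly one element. *)
Definition dowling_bot : set Q := [set q |
  zero_block (repr q) = finset.set0 /\
  nonzero_blocks (repr q) = [set [set i]%SET | i : 'I_n]%SET].

Definition dowling_J (J : pred nat) : set Q :=
  dowling_bot `|` [set q | #|zero_block (repr q)| \notin J].

(* The condition on the labels does not depend on the representative, since it
   involves all the residues [j] at once and [k] is meant to divide [s]. *)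
Definition dowling_dk (d k : nat) : set Q :=
  dowling_bot `|` [set q | forall B, B \in nonzero_blocks (repr q) ->
    d %| #|B| /\
    forall j j' : nat,
      #|[set a in B | label (repr q) a == j %[mod k]]%SET| =
      #|[set a in B | label (repr q) a == j' %[mod k]]%SET|].

Definition dowling_dkJ (d k : nat) (J : pred nat) : set Q :=
  dowling_bot `|`
  (dowling_dk d k `&` [set q | #|zero_block (repr q)| \notin J]).

End DowlingLattice.

Arguments dowling_le {n s}.

Definition partition_lattice n : set {set {set 'I_n}} :=
  [set P | finset.partition P [set: 'I_n]%SET].

Definition refines n (P P' : {set {set 'I_n}}) : Prop :=
  forall B, B \in P -> exists2 B', B' \in P' & B \subset B'.

Definition poset_iso (T U : Type) (A : set T) (leT : T -> T -> Prop)
    (B : set U) (leU : U -> U -> Prop) : Prop :=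
  exists2 f : T -> U, set_bij A B f
    & forall x y, A x -> A y -> (leT x y <-> leU (f x) (f y)).

Local Open Scope ring_scope.

Section ReflectionGroups.
Variables (C : fieldType) (n : nat).

Definition monomial (x : 'M[C]_n) : Prop :=
  (forall i, #|[set j | x i j != 0]%SET| = 1%N) /\
  (forall j, #|[set i | x i j != 0]%SET| = 1%N).

Definition Grpn (r p : nat) : set 'M[C]_n := [set x |
  [/\ monomial x,
      forall i j, x i j != 0 -> r.-unity_root (x i j)
    & (r %/ p)%N.-unity_root (\prod_i \prod_(j | x i j != 0) x i j)]].

Definition eigsp (x : 'M[C]_n) (zeta : C) : {vspace 'cV[C]_n} :=
  passmx.leigenspace (linfun (mulmx x)) zeta.

Lemma mem_eigsp x zeta v : (v \in eigsp x zeta) = (x *m v == zeta *: v).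
Proof.
by rewrite memv_ker !lfun_simp subr_eq0.
Qed.

Definition eigenspaces (zeta : C) (X : set 'M[C]_n) : set {vspace 'cV[C]_n} :=
  [set eigsp x zeta | x in X].

Definition rev_incl (U W : {vspace 'cV[C]_n}) : Prop := (W <= U)%VS.

Definition diag1 (xi : C) : 'M[C]_n :=
  diag_mx (\row_(i < n) if i == 0%N :> nat then xi else 1).

Definition left_translate (g : 'M[C]_n) (X : set 'M[C]_n) : set 'M[C]_n :=
  [set g *m x | x in X].

End ReflectionGroups.

(* Main.v *)
From mathcomp Require Import all_fingroup zify ring.
Require Import Defs.

Set Implicit Arguments.
Unset Strict Implicit.
Unset Printing Implicit Defensive.

(* To a prepartition (I, pi, lambda) in Q_n(s) and a primitive s-th root of unity
   w attach the subspace U of vectors v vanishing on I and, on each block, with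
   v_a proportional to w^(lambda a).  Then U determines the class, and reverse
   inclusion of these subspaces is the order of Q_n(s), so every case amounts to
   deciding, with s = dr, which prepartitions give eigenspaces of gamma G.
   An element of gamma G is a permutation sigma with weights c_i in mu_r:
   (M v)_i = c_i v_(sigma i).  A cycle of length l with weight product c
   contributes a line to V(M, zeta) if c = zeta^l and nothing otherwise, so V(M,
   zeta) = U, where I is the union of the cycles of the second kind.  Along a
   nonzero block sigma shifts the labels mod d by a fixed unit, hence the
   labels are equidistributed mod d; conversely such a block can be listed as a
   cycle shifting the labels.  The remaining freedom is the choice of cycles and
   weight products on I, and the coset condition on the product of all weights
   can be met except when I is empty and zeta^n is in the wrong coset, or when
   |I| = 1, r = p and zeta^n is the value prescribed by the coset. *)

Import GRing.Theory mathcomp.boot.finset.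
Local Open Scope ring_scope.

(** * Prepartitions and the order of the Dowling lattice *)

Section Blocks.
Variables n s : nat.
Implicit Types (x y : prepart n s) (a b : 'I_n) (B : {set 'I_n}).

(** [pblock] is empty off the cover, so [blk x] is a function on all points, with value [set0]
    exactly on the zero block. Its fibres are the zero block and the nonzero blocks. *)
Definition blk x a : {set 'I_n} := pblock (nonzero_blocks x) a.

Lemma nonzero_blocksP x :
  partition (nonzero_blocks x) (~: zero_block x)%SET.
Proof. exact: valP x. Qed.

Lemma mem_blk x a : (a \in blk x a) = (a \notin zero_block x).
Proof. by rewrite mem_pblock (cover_partition (nonzero_blocksP x)) inE. Qed.

Lemma blk_mem x a : a \notin zero_block x -> blk x a \in nonzero_blocks x.
Proof.
by move=> az; rewrite pblock_mem// (cover_partition (nonzero_blocksP x)) inE.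
Qed.

Lemma blk_def x B a : B \in nonzero_blocks x -> a \in B -> blk x a = B.
Proof.
by move=> BP aB; apply: def_pblock => //; case/and3P: (nonzero_blocksP x).
Qed.

Lemma blk_eq0 x a : (blk x a == set0) = (a \in zero_block x).
Proof.
apply/idP/idP => [/eqP e|az].
  by apply/negPn; rewrite -mem_blk e inE.
apply: contraTT az => /set0Pn[b bb]; rewrite -mem_blk.
have bB : blk x a \in nonzero_blocks x.
  rewrite /blk /pblock; case: pickP => [B /andP[]//|/= h].
  by move: bb; rewrite /blk /pblock; case: pickP => [B|_]; rewrite ?h //= inE.
by move: bb; rewrite /blk /pblock; case: pickP => [B /andP[]//|_]; rewrite /= inE.
Qed.

Lemma nonzero_blocks_ne0 x B : B \in nonzero_blocks x -> B != set0.
Proof. exact: partition_neq0 (nonzero_blocksP x). Qed.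

Lemma nonzero_blocks_notin x B a :
  B \in nonzero_blocks x -> a \in B -> a \notin zero_block x.
Proof. by move=> BP aB; rewrite -blk_eq0 (blk_def BP aB) (nonzero_blocks_ne0 BP). Qed.

Lemma blk_same x a b : b \in blk x a -> blk x b = blk x a.
Proof.
move=> ba; apply: (blk_def _ ba); apply: blk_mem.
by rewrite -blk_eq0; apply/set0Pn; exists b.
Qed.

Lemma blk_eqE x a b : a \notin zero_block x -> (blk x a == blk x b) = (b \in blk x a).
Proof.
move=> az; apply/eqP/idP => [e|/blk_same->//].
by rewrite e mem_blk -blk_eq0 -e blk_eq0.
Qed.

Lemma nonzero_blocksE x B :
  (B \in nonzero_blocks x) = [exists a in B, blk x a == B].
Proof.
apply/idP/exists_inP => [BP|[a aB /eqP e]].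
  have /set0Pn[a aB] := nonzero_blocks_ne0 BP.
  by exists a => //; rewrite (blk_def BP aB).
by rewrite -e blk_mem// -blk_eq0 e; apply/set0Pn; exists a.
Qed.

(** Closed form of the order generated by merging: the blocks of [x] coarsen to those of [y], and on
    a block of [x] not absorbed by the zero block of [y] the difference [label y - label x] is
    constant mod [s]. The congruence is cross-added to avoid subtraction in [nat]. *)
Definition prepart_le x y : Prop :=
  (forall a, blk x a = set0 -> blk y a = set0) /\
  forall a b, blk x a = blk x b -> blk y a = blk y b /\
    (blk y a <> set0 ->
      (label y a + label x b)%N = (label y b + label x a)%N %[mod s]).

Lemma prepart_equiv_le x y : prepart_equiv x y -> prepart_le x y.
Proof.
move=> /prepart_equivP[ez en h].
have eb a : blk y a = blk x a by rewrite /blk en.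
split=> [a|a b e]; rewrite !eb// e; split=> // b0; rewrite -e in b0.
have az : a \notin zero_block x by rewrite -blk_eq0; apply/eqP.
have [g hg] := h _ (blk_mem az).
have aB := az; rewrite -mem_blk in aB.
have bB : b \in blk x a by rewrite -blk_eqE// e.
by rewrite -modnDml hg// modnDml -[in RHS]modnDml hg// modnDml; congr (_ %% _)%N; lia.
Qed.

Lemma merge_zero_blk x y B : B \in nonzero_blocks x ->
    zero_block y = zero_block x :|: B -> nonzero_blocks y = nonzero_blocks x :\ B ->
  forall a, blk y a = if blk x a == B then set0 else blk x a.
Proof.
move=> BP ez en a; have B0 := nonzero_blocks_ne0 BP.
have [aB|aB] := eqVneq (blk x a) B.
  apply/eqP; rewrite blk_eq0 ez inE -[in X in _ || X]aB mem_blk.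
  by rewrite orbN.
have [a0|a0] := eqVneq (blk x a) set0.
  by rewrite a0; apply/eqP; rewrite blk_eq0 ez inE -blk_eq0 a0 eqxx.
apply: blk_def; last by rewrite mem_blk -blk_eq0.
by rewrite en !inE aB blk_mem// -blk_eq0.
Qed.

Lemma merge_nonzero_blk x y B B' :
    B \in nonzero_blocks x -> B' \in nonzero_blocks x ->
    zero_block y = zero_block x ->
    nonzero_blocks y = (B :|: B') |: (nonzero_blocks x :\ B :\ B') ->
  forall a, blk y a =
    if (blk x a == B) || (blk x a == B') then B :|: B' else blk x a.
Proof.
move=> BP B'P ez en a.
have [a0|a0] := eqVneq (blk x a) set0.
  rewrite a0 eq_sym (negbTE (nonzero_blocks_ne0 BP)).
  rewrite eq_sym (negbTE (nonzero_blocks_ne0 B'P)).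
  by apply/eqP; rewrite blk_eq0 ez -blk_eq0 a0.
have am : a \in blk x a by rewrite mem_blk -blk_eq0.
have [aB|/norP[aB aB']] := ifP.
  apply: blk_def; first by rewrite en !inE eqxx.
  by rewrite inE; case/orP: aB am => /eqP -> ->; rewrite ?orbT.
by apply: blk_def => //; rewrite en !inE aB aB' blk_mem ?orbT// -blk_eq0.
Qed.

Lemma merge_zero_le x y : merge_zero x y -> prepart_le x y.
Proof.
move=> [B BP [ez en el]]; have yx := merge_zero_blk BP ez en.
split=> [a|a b]; rewrite !yx => ->; first by rewrite if_same.
by split=> // _; rewrite el addnC.
Qed.

Lemma merge_nonzero_le x y : merge_nonzero x y -> prepart_le x y.
Proof.
move=> [B [B' [g [[BP B'P BB'] [ez en l1 l2]]]]].
have yx := merge_nonzero_blk BP B'P ez en.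
split=> [a /eqP|a b e].
  by rewrite blk_eq0 => az; apply/eqP; rewrite blk_eq0 ez.
split; first by rewrite !yx e.
move=> /eqP a0; rewrite blk_eq0 ez -mem_blk in a0.
have [aB|aB] := boolP (a \in B').
  have bB : b \in B'.
    by rewrite -(blk_def B'P aB) e mem_blk -blk_eq0 -e blk_eq0 -mem_blk.
  by rewrite -modnDml l2// modnDml -[in RHS]modnDml l2// modnDml; congr (_ %% _)%N; lia.
rewrite (l1 a)// (l1 b); first by rewrite addnC.
by apply: contra aB => bB; rewrite -(blk_def B'P bB) -e.
Qed.

Lemma prepart_le_anti x y : prepart_le x y -> prepart_le y x -> prepart_equiv x y.
Proof.
move=> [xy0 xy] [yx0 yx].
have ez : zero_block x = zero_block y.
  by apply/setP=> a; rewrite -!blk_eq0; apply/eqP/eqP; [apply: xy0|apply: yx0].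
have eb a : blk x a = blk y a.
  have [az|az] := boolP (a \in zero_block x).
    by move: (az); rewrite {2}ez -!blk_eq0 in az *; move: az => /eqP-> /eqP->.
  apply/setP=> b; rewrite -!blk_eqE// -?ez//.
  by apply/eqP/eqP => [/xy[]|/yx[]].
apply/prepart_equivP; split=> //.
  by apply/setP=> B; rewrite !nonzero_blocksE; apply: eq_existsb => a; rewrite eb.
move=> B BP; have /set0Pn[b bB] := nonzero_blocks_ne0 BP.
(* Multiplication by [s.-1] is negation mod [s]: the shift is [label y b - label x b] at the base
   point [b]. *)
exists (label y b + label x b * s.-1)%N => a aB.
have s0 : (0 < s)%N by exact: leq_ltn_trans (ltn_ord (label x a)).
have [_ h] := xy a b (etrans (blk_def BP aB) (esym (blk_def BP bB))).
have /h{}h : blk y a <> set0.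
  by rewrite -eb (blk_def BP aB); apply/eqP; apply: nonzero_blocks_ne0 BP.
rewrite addnA [(label x a + _)%N]addnC -modnDml -h modnDml.
by rewrite -addnA -mulnS prednK// addnC modnMDl.
Qed.

Lemma modn_eq_dvdz (m k q : nat) :
  (m = k %[mod q])%N <-> (q %| m%:Z - k%:Z)%Z.
Proof.
rewrite -eqz_mod_dvd; split=> [e|/eqP e].
  by apply/eqP; rewrite !modz_nat e.
by move: e; rewrite !modz_nat => -[].
Qed.

Local Notation cls := (\pi_(dowling n s))%qT.

(* As long as x is not equivalent to y, either a nonzero block of x lies in the
   zero block of y, or two of them lie in the same nonzero block of y; merge. *)
Lemma prepart_le_dowling x y : prepart_le x y -> dowling_le (cls x) (cls y).
Proof.
have [m] := ubnP #|nonzero_blocks x|; elim: m x => // m IHm x ltm xy.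
have [xy0 xyl] := xy.
have [[a a0 ya0]|nP1] := pselect (exists2 a, blk x a <> set0 & blk y a = set0).
  have az : a \notin zero_block x by rewrite -blk_eq0; apply/eqP.
  have BP := blk_mem az; set B := blk x a in BP.
  have Qp : partition (nonzero_blocks x :\ B) (~: (zero_block x :|: B)).
    by rewrite setCU -setDE; apply: partitionD1 => //; apply: nonzero_blocksP.
  pose x' := @Prepart n s (_, _, label x) Qp.
  have xx' := @merge_zero_blk x x' B BP erefl erefl.
  have By b : blk x b = B -> blk y b = set0 by move=> e; rewrite -ya0; apply: (proj1 (xyl _ _ e)).
  apply: (@rt_trans _ _ _ (cls x')).
    by apply: rt_step; exists x, x'; split=> //; left; exists B.
  apply: IHm.
    by move: ltm; rewrite (cardsD1 B) BP.
  split=> [b|b c]; rewrite !xx'; first by case: eqP => [/By->//|_]; apply: xy0.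
  case: eqP => [/By->|_]; case: eqP => [/By->|_] //.
  - by move=> e; rewrite xy0.
  - by move=> /xy0->.
  - exact: xyl.
have [[a [b [ya0 ab yab]]]|nP2] := pselect (exists a b,
    [/\ blk y a <> set0, blk x a != blk x b & blk y a = blk y b]).
  have az : a \notin zero_block x by rewrite -blk_eq0; apply/eqP => /xy0.
  have bz : b \notin zero_block x.
    by rewrite -blk_eq0; apply/eqP => /xy0; rewrite -yab.
  have BP := blk_mem az; have B'P := blk_mem bz.
  set B := blk x a in ab BP; set B' := blk x b in ab B'P.
  have B0 := nonzero_blocks_ne0 BP; have B'0 := nonzero_blocks_ne0 B'P.
  have s0 : (0 < s)%N by exact: leq_ltn_trans (ltn_ord (label x a)).
  (* Mod [s], [g] is the offset [label y - label x] at [b] minus the same offset at [a]. Shifting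
     [B'] by it makes the offset constant on the merged block. *)
  pose g := (label y b + label x a + s.-1 * (label y a + label x b))%N.
  pose l := [ffun c => if c \in B' then Ordinal (ltn_pmod (label x c + g)%N s0)
                       else label x c].
  have Qp : partition ((B :|: B') |: (nonzero_blocks x :\ B :\ B')) (~: zero_block x).
    have h1 := partitionD1 (nonzero_blocksP x) BP.
    have B'P1 : B' \in nonzero_blocks x :\ B by rewrite !inE eq_sym ab.
    have h2 := partitionD1 h1 B'P1.
    have := partitionU1 (B := B :|: B') h2.
    have -> : (B :|: B') :|: (~: zero_block x :\: B :\: B') = ~: zero_block x.
      have sBB : B :|: B' \subset ~: zero_block x.
        by rewrite subUset !(partitionS (nonzero_blocksP x)).
      by rewrite setDDl -[in RHS](setID (~: zero_block x) (B :|: B')) (setIidPr sBB).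
    apply.
      by apply: contraNneq B0 => /eqP; rewrite setU_eq0 => /andP[].
    rewrite -setI_eq0; apply/eqP/setP => c; rewrite !inE.
    by case: (c \in B); case: (c \in B').
  pose x' := @Prepart n s (_, _, l) Qp.
  have xx' := @merge_nonzero_blk x x' B B' BP B'P erefl erefl.
  have l1 c : c \notin B' -> label x' c = label x c.
    by rewrite /label /= ffunE => /negbTE ->.
  have l2 c : c \in B' -> (label x' c = label x c + g %[mod s])%N.
    by rewrite /label /= ffunE => -> /=; rewrite modn_mod.
  apply: (@rt_trans _ _ _ (cls x')).
    by apply: rt_step; exists x, x'; split=> //; right; exists B, B', g.
  apply: IHm.
    rewrite ltnS in ltm; apply: (leq_trans _ ltm).
    rewrite (cardsD1 B (nonzero_blocks x)) BP.
    rewrite (cardsD1 B' (_ :\ _)) !inE eq_sym ab B'P /=.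
    apply: leq_ltn_trans (leq_card_setU _ _) _.
    by rewrite cards1.
  have es : s%:Z = s.-1%:Z + 1 by rewrite -[in LHS](prednK s0) -addn1 PoszD.
  have mB c : (c \in B') = (blk x c == B').
    by apply/idP/eqP => [/(blk_def B'P)//|e]; rewrite -e mem_blk -blk_eq0 e.
  have aB : a \in B by rewrite mem_blk.
  have aB' : a \notin B' by rewrite mB.
  have Py c : (blk x c == B) || (blk x c == B') -> blk y c = blk y a /\
      (label y c + label x' a = label y a + label x' c %[mod s])%N.
    have [cB' _|cB' /=] := eqVneq (blk x c) B'.
      have [e h] := xyl _ _ cB'; rewrite e -yab; split=> //; move: h.
      rewrite e -yab => /(_ ya0) /modn_eq_dvdz h; apply/modn_eq_dvdz.
      have := l2 c; rewrite mB cB' eqxx => /(_ isT) /modn_eq_dvdz h2; rewrite l1//.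
      move: h h2; rewrite /g => h h2.
      rewrite (_ : _ - _ = (label y c + label x b)%N%:Z - (label y b + label x c)%N%:Z
        - ((label x' c)%:Z - (label x c + g)%N%:Z)
        + s%:Z * - (label y a + label x b)%N%:Z); last by rewrite !PoszD PoszM es; ring.
      by rewrite rpredD ?dvdz_mulr// rpredB.
    rewrite orbF => /eqP /xyl[e h]; split=> //; rewrite l1// l1 ?mB//.
    by apply: h; rewrite e.
  have nP c : (blk x c == B) || (blk x c == B') = false -> B :|: B' <> blk x c.
    move=> cB e; have /blk_same : a \in blk x c by rewrite -e inE aB.
    by move=> ac; move: cB; rewrite -ac eqxx.
  split=> [c|c c']; rewrite !xx'.
    by case: ifP => [_ /eqP|_ /xy0//]; rewrite setU_eq0 (negbTE B0).
  case: ifP => [/Py[-> h]|cB]; case: ifP => [/Py[-> h']|cB'].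
  - move=> _; split=> // _; move: h h' => /modn_eq_dvdz h /modn_eq_dvdz h'.
    apply/modn_eq_dvdz; have := rpredB h h'.
    by rewrite (_ : _ - _ - (_ - _) = (label y c + label x' c')%N%:Z -
      (label y c' + label x' c)%N%:Z)// !PoszD; ring.
  - by move=> /nP.
  - by move=> /esym/nP.
  - by move: cB cB' => /norP[_ cB] /norP[_ cB'] /xyl; rewrite !l1 ?mB.
(* Neither merge is available, so [x] and [y] have the same zero block and the same blocks; the
   relation then holds in both directions. *)
suff /prepart_le_anti h : prepart_le y x.
  rewrite (_ : cls x = cls y); first exact: rt_refl.
  by apply/eqmodP; rewrite /= prepart_equiv_sym; apply: h.
split=> [a ya0|a b yab].
  by apply: contrapT => xa0; apply: nP1; exists a.
have [ya0|ya0] := pselect (blk y a = set0).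
  have xa0 : blk x a = set0 by apply: contrapT => xa0; apply: nP1; exists a.
  have xb0 : blk x b = set0 by apply: contrapT => xb0; apply: nP1; exists b; rewrite -?yab.
  by rewrite xa0 xb0.
have xab : blk x a = blk x b.
  by apply: contrapT => /eqP xab; apply: nP2; exists a, b.
split=> // _; have [_ /(_ ya0) h] := xyl _ _ xab.
by rewrite addnC -h addnC.
Qed.
(** Builds a prepartition whose blocks are the fibres of a key outside [Z], for instance the orbits
    of a permutation. *)
Lemma prepart_exists (T : eqType) (Z : {set 'I_n}) (key : 'I_n -> T)
    (l : {ffun 'I_n -> 'I_s}) :
  exists x, [/\ zero_block x = Z, label x = l &
    forall a b, a \notin Z -> b \notin Z -> blk x a = blk x b <-> key a = key b].
Proof.
have eqk : {in ~: Z & &, equivalence_rel (fun a b => key a == key b)}.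
  by split=> // /eqP->.
pose x := @Prepart n s (_, _, l) (equivalence_partitionP eqk).
have xb a b : a \notin Z -> b \notin Z -> (b \in blk x a) = (key a == key b).
  by move=> az bz; apply: (pblock_equivalence_partition eqk); rewrite inE.
exists x; split=> // a b az bz; have e := xb a b az bz; rewrite -blk_eqE// in e.
by split=> /eqP; [rewrite e|rewrite -e] => /eqP.
Qed.

End Blocks.

(** * The subspace attached to a prepartition *)

Section Subspaces.
Variables (C : fieldType) (n s : nat) (w : C).
Hypothesis hw : s.-primitive_root w.
Implicit Types (x y : prepart n s) (a b : 'I_n) (v : 'cV[C]_n).

Lemma prim_neq0 : w != 0.
Proof. by rewrite (prim_root_eq0 hw) -lt0n (prim_order_gt0 hw). Qed.

Lemma eqmod_prim i j : w ^+ i = w ^+ j <-> (i = j %[mod s])%N.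
Proof. by split=> /eqP h; apply/eqP; rewrite (eq_prim_root_expr hw) in h *. Qed.

(** Linear forms with the attached subspace as common kernel, indexed by all pairs so that a single
    intersection suffices. Pairs in different blocks get the zero form, hence no constraint. *)
Definition row_constraint x (ab : 'I_n * 'I_n) : 'rV[C]_n :=
  let: (a, b) := ab in
  if blk x a == set0 then delta_mx 0 a
  else if blk x a == blk x b then
    w ^+ label x b *: delta_mx 0 a - w ^+ label x a *: delta_mx 0 b
  else 0.

Definition prepart_space x : {vspace 'cV[C]_n} :=
  (\bigcap_ab lker (linfun (mulmx (row_constraint x ab))))%VS.

Lemma mem_prepart_space x v : v \in prepart_space x <->
  (forall a, blk x a = set0 -> v a 0 = 0) /\
  (forall a b, blk x a = blk x b ->
     w ^+ label x b * v a 0 = w ^+ label x a * v b 0).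
Proof.
have dm a : (delta_mx 0 a : 'rV_n) *m v = (v a 0)%:M.
  by rewrite -rowE; apply/rowP => i; rewrite !mxE ord1 eqxx.
have sm (c : C) : (c%:M == 0 :> 'M_1) = (c == 0).
  by apply/eqP/eqP => [/matrixP /(_ 0 0)|->]; rewrite ?raddf0// !mxE eqxx.
rewrite memvE; split=> [/subv_bigcapP h|[h1 h2]].
  have {}h a b : row_constraint x (a, b) *m v == 0.
    by have := h (a, b) isT; rewrite -memvE memv_ker lfunE.
  have h0 a : blk x a = set0 -> v a 0 = 0.
    by move=> e; have := h a a; rewrite /= e eqxx dm sm => /eqP.
  split=> // a b e; have [xa|xa] := eqVneq (blk x a) set0.
    by rewrite !h0 -?e ?mulr0.
  have := h a b; rewrite /= (negbTE xa) e eqxx mulmxBl -!scalemxAl !dm.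
  by rewrite !scale_scalar_mx -raddfB sm subr_eq0 => /eqP.
apply/subv_bigcapP => -[a b] _; rewrite -memvE memv_ker lfunE /=.
case: ifP => [/eqP/h1 e|_]; first by rewrite dm sm e.
case: ifP => [/eqP/h2 e|_]; last by rewrite mul0mx.
rewrite mulmxBl -!scalemxAl !dm.
by rewrite !scale_scalar_mx -raddfB sm subr_eq0 e.
Qed.

(** Spans the line contributed by the block of [a]; it is the zero vector when [a] lies in the zero
    block. *)
Definition block_vector y a : 'cV[C]_n :=
  \col_i (if i \in blk y a then w ^+ label y i else 0).

Lemma block_vector_in y a : block_vector y a \in prepart_space y.
Proof.
apply/mem_prepart_space; split=> [b e|b c e]; rewrite !mxE.
  by case: ifP => // ba; have := ba; rewrite -(blk_same ba) e inE.
have same b1 c1 : blk y b1 = blk y c1 -> c1 \in blk y a -> b1 \in blk y a.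
  move=> e1 h; rewrite -(blk_same h) -e1 mem_blk -blk_eq0 e1 (blk_same h).
  by apply/set0Pn; exists c1.
have -> : (c \in blk y a) = (b \in blk y a) by apply/idP/idP; apply: same.
by case: ifP => _; rewrite ?mulr0// mulrC.
Qed.

(** For the converse, the inclusion is tested on the block vectors of [y]. Their nonzero coordinates
    keep [blk x a] from being empty and propagate along the blocks of [x], and ratios of coordinates
    determine label differences mod [s] because [w] is primitive. *)
Lemma prepart_space_sub x y :
  prepart_le x y <-> (prepart_space y <= prepart_space x)%VS.
Proof.
split=> [[xy0 xy]|/subvP h].
  apply/subvP => v /mem_prepart_space[h1 h2]; apply/mem_prepart_space.
  split=> [a /xy0/h1//|a b /xy[e]].
  have [a0|/eqP a0] := eqVneq (blk y a) set0.
    by rewrite !h1 -?e// !mulr0.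
  move=> /(_ a0) /eqmod_prim; rewrite !exprD => hl.
  apply: (mulfI (expf_neq0 (label y a) prim_neq0)).
  by rewrite mulrA hl mulrAC h2// mulrAC mulrA.
have hv a := iffLR (mem_prepart_space _ _) (h _ (block_vector_in y a)).
have wn0 i : w ^+ i != 0 by rewrite expf_neq0 ?prim_neq0.
have va a : blk y a != set0 -> block_vector y a a 0 = w ^+ label y a.
  by rewrite mxE blk_eq0 -mem_blk => ->.
have same a b : blk x a = blk x b -> blk y a != set0 -> b \in blk y a.
  move=> e a0; have := (hv a).2 _ _ e; rewrite va// mxE; case: ifP => // _ /eqP.
  by rewrite mulr0 mulf_eq0 !(negbTE (wn0 _)).
split=> [a xa|a b e].
  apply/eqP; rewrite -[_ == _]negbK; apply/negP => a0.
  by have /eqP := (hv a).1 _ xa; rewrite va// (negbTE (wn0 _)).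
have eab : blk y a = blk y b.
  have [a0|a0] := eqVneq (blk y a) set0; last by rewrite (blk_same (same _ _ e a0)).
  have [b0|b0] := eqVneq (blk y b) set0; first by rewrite a0.
  by rewrite (blk_same (same _ _ (esym e) b0)).
split=> // /eqP a0; have := (hv a).2 _ _ e.
rewrite va// mxE same// -!exprD => /eqmod_prim.
by rewrite addnC => ->; rewrite addnC.
Qed.

Lemma prepart_space_equiv x y : prepart_equiv x y -> prepart_space x = prepart_space y.
Proof.
move=> xy; apply: subv_anti.
by apply/andP; split; apply/prepart_space_sub; apply: prepart_equiv_le; rewrite // prepart_equiv_sym.
Qed.

Local Notation Q := (dowling n s).
Local Notation cls := (\pi_(dowling n s))%qT.

Definition dowling_space (q : Q) := prepart_space (repr q).

Lemma dowling_space_cls x : dowling_space (cls x) = prepart_space x.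
Proof. by apply: prepart_space_equiv; apply/eqmodP; rewrite reprK. Qed.

Lemma dowling_leP (q q' : Q) :
  dowling_le q q' <-> (dowling_space q' <= dowling_space q)%VS.
Proof.
split=> [|/prepart_space_sub/prepart_le_dowling]; last by rewrite !reprK.
elim=> [{}q {}q' [x [y [<- <- h]]]|//|? ? ? _ h1 _ h2]; last exact: subv_trans h2 h1.
rewrite !dowling_space_cls; apply/prepart_space_sub.
by case: h => [/merge_zero_le|/merge_nonzero_le].
Qed.

Lemma dowling_space_inj : injective dowling_space.
Proof.
rewrite /dowling_space => q q' e; rewrite -[q]reprK -[q']reprK; apply/eqmodP.
by apply: prepart_le_anti; apply/prepart_space_sub; rewrite e.
Qed.

End Subspaces.

(** The natural map goes from prepartitions to subspaces, against the direction of the required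
    isomorphism, so its inverse is obtained by choice. The point [u0] is the value outside [A]. *)
Lemma poset_iso_of_inverse (T U : Type) (u0 : U) (A : set T) (leT : T -> T -> Prop)
    (B : set U) (leU : U -> U -> Prop) (g : U -> T) :
  (forall u, B u -> A (g u)) -> (forall t, A t -> exists2 u, B u & g u = t) ->
  (forall u u', B u -> B u' -> g u = g u' -> u = u') ->
  (forall u u', B u -> B u' -> (leU u u' <-> leT (g u) (g u'))) ->
  poset_iso A leT B leU.
Proof.
move=> gB gA gI gle.
have /choice[f hf] : forall t, exists u, A t -> B u /\ g u = t.
  move=> t; have [/gA[u Bu <-]|At] := pselect (A t); first by exists u.
  by exists u0 => /At.
exists f => [|t t' At At'].
  split=> [t /hf[]//|t t' /set_mem At /set_mem At' e|u Bu].
    by rewrite -(proj2 (hf t At)) -(proj2 (hf t' At')) e.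
  have [Bf gf] := hf _ (gB _ Bu); exists (g u); first exact: gB.
  exact: gI.
have [Bt gt] := hf _ At; have [Bt' gt'] := hf _ At'.
by rewrite gle// gt gt'.
Qed.

(** * Monomial matrices and their eigenspaces *)

Section MonomialMatrices.
Variables (C : fieldType) (n : nat).
Implicit Types (sigma : {perm 'I_n}) (c : 'I_n -> C) (v : 'cV[C]_n) (zeta : C).

Definition monomial_mx sigma c : 'M[C]_n := \matrix_(i, j) (c i *+ (j == sigma i)).

Lemma mem_eigsp_monomial sigma c zeta v :
  v \in eigsp (monomial_mx sigma c) zeta <->
  forall i, c i * v (sigma i) 0 = zeta * v i 0.
Proof.
have hM i : (monomial_mx sigma c *m v) i 0 = c i * v (sigma i) 0.
  rewrite mxE (bigD1 (sigma i)) //= mxE eqxx big1 ?addr0// => j /negbTE ji.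
  by rewrite mxE ji mul0r.
rewrite mem_eigsp; split=> [/eqP h i|h]; first by rewrite -hM h mxE.
by apply/eqP/colP => i; rewrite hM h mxE.
Qed.

(** The row condition gives the column of the only nonzero entry of each row, and the column
    condition makes this assignment injective, hence a permutation. *)
Lemma GrpnP (r p : nat) (X : 'M[C]_n) : (0 < r)%N ->
  Grpn r p X <-> exists sigma c, [/\ X = monomial_mx sigma c,
    forall i, c i ^+ r = 1 & (\prod_i c i) ^+ (r %/ p) = 1].
Proof.
move=> r0.
have prodE sigma c : (forall i, c i != 0) ->
    \prod_i \prod_(j | monomial_mx sigma c i j != 0) monomial_mx sigma c i j =
    \prod_i c i.
  move=> c0; apply: eq_bigr => i _.
  rewrite (big_pred1 (sigma i)) => [|j]; first by rewrite mxE eqxx.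
  by rewrite mxE /=; case: (j == _); rewrite ?eqxx ?c0.
split=> [[[rowX colX] Xr Xp]|[sigma [c [-> cr cp]]]].
  have /choice[f fP] : forall i, exists j, forall j', (X i j' != 0) = (j' == j).
    move=> i; have /eqP/cards1P[j /setP e] := rowX i.
    by exists j => j'; have := e j'; rewrite !inE.
  have f_inj : injective f.
    move=> i i' e; have /eqP/cards1P[i0 /setP h] := colX (f i).
    have := h i; have := h i'; rewrite !inE !fP -?e ?e eqxx.
    by move=> /esym/eqP-> /esym/eqP->.
  have eX : X = monomial_mx (perm f_inj) (fun i => X i (f i)).
    apply/matrixP => i j; rewrite mxE permE.
    have [->|ji] := eqVneq j (f i) => //=.
    by have := fP i j; rewrite (negbTE ji) => /negbFE/eqP.
  have X0 i : X i (f i) != 0 by rewrite fP.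
  exists (perm f_inj), (fun i => X i (f i)); split=> // [i|].
    by have := Xr _ _ (X0 i); rewrite unity_rootE => /eqP.
  by move: Xp; rewrite {1 2}eX prodE// unity_rootE => /eqP.
have c0 i : c i != 0.
  by apply: contra_eq_neq (cr i) => ->; rewrite expr0n (gtn_eqF r0) eq_sym oner_eq0.
have nz i j : (monomial_mx sigma c i j != 0) = (j == sigma i).
  by rewrite mxE; case: (j == _); rewrite ?eqxx ?c0.
split; last by rewrite prodE// unity_rootE; apply/eqP.
  split=> i; apply/eqP/cards1P.
    by exists (sigma i); apply/setP => j; rewrite !inE nz.
  exists (sigma^-1%g i); apply/setP => j; rewrite !inE nz eq_sym.
  by apply/eqP/eqP => [<-|->]; rewrite ?permK ?permKV.
by move=> i j; rewrite nz => /eqP->; rewrite mxE eqxx unity_rootE mulr1n cr.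
Qed.

(** Multiplication by [diag1 n x] only multiplies the weight of the first row by [x], so it shifts
    the product of the weights by [x]; the inverse translation uses [x^-1]. *)
Lemma left_translateP (r p : nat) (x : C) (M : 'M[C]_n) :
  (0 < r)%N -> (0 < n)%N -> x ^+ r = 1 ->
  left_translate (diag1 n x) (Grpn r p) M <->
  exists sigma c, [/\ M = monomial_mx sigma c,
    forall i, c i ^+ r = 1 & (\prod_i c i) ^+ (r %/ p) = x ^+ (r %/ p)].
Proof.
move=> r0 n0 xr; pose g (y : C) (i : 'I_n) := if i == 0%N :> nat then y else 1.
have gM y sigma c :
    diag1 n y *m monomial_mx sigma c = monomial_mx sigma (fun i => g y i * c i).
  by apply/matrixP => i j; rewrite mul_diag_mx !mxE mulrnAr.
have gr y i : y ^+ r = 1 -> g y i ^+ r = 1.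
  by rewrite /g; case: ifP; rewrite ?expr1n.
have gp y : \prod_i g y i = y.
  rewrite (bigD1 (Ordinal n0))//= /g/= big1 ?mulr1// => i /eqP i0.
  by case: eqP => // e; case: i0; apply: val_inj.
have x0 : x != 0.
  by apply: contra_eq_neq xr => ->; rewrite expr0n (gtn_eqF r0) eq_sym oner_eq0.
split=> [[X /(GrpnP _ _ r0)[sigma [c [-> cr cp]]] <-]|[sigma [c [-> cr cp]]]].
  exists sigma, (fun i => g x i * c i); split=> [|i|]; first exact: gM.
    by rewrite exprMn gr// cr mulr1.
  by rewrite big_split/= gp exprMn cp mulr1.
exists (monomial_mx sigma (fun i => g x^-1 i * c i)).
  apply/(GrpnP _ _ r0); exists sigma, (fun i => g x^-1 i * c i); split=> // [i|].
    by rewrite exprMn gr ?exprVn ?xr ?invr1// cr mulr1.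
  by rewrite big_split/= gp exprMn cp -exprMn mulVf// expr1n.
rewrite gM; congr monomial_mx; apply/funext => i; rewrite mulrA /g.
by case: ifP => _; rewrite ?mulfV ?mul1r.
Qed.

End MonomialMatrices.

(** * Every eigenspace comes from a prepartition *)

Section EigenspaceToPrepart.
Variables (C : fieldType) (n s : nat) (w : C).
Hypothesis hw : s.-primitive_root w.
Variables (sigma : {perm 'I_n}) (c : 'I_n -> C) (zeta : C).
Hypotheses (cs : forall i, c i ^+ s = 1) (zs : zeta ^+ s = 1).

Let E := eigsp (monomial_mx sigma c) zeta.

Lemma unity_neq0 (t : C) : t ^+ s = 1 -> t != 0.
Proof.
apply: contra_eq_neq => ->.
by rewrite expr0n (gtn_eqF (prim_order_gt0 hw)) eq_sym oner_eq0.
Qed.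

(* The labels are read off the eigenvectors: on an orbit of sigma, the ratios of
   the coordinates are the same for all eigenvectors, and they lie in mu_s. *)
Lemma eigenspace_prepart : exists x : prepart n s, prepart_space w x = E.
Proof.
have c0 i : c i != 0 by apply: unity_neq0.
have z0 : zeta != 0 by apply: unity_neq0.
have EP v : v \in E <-> forall i, c i * v (sigma i) 0 = zeta * v i 0.
  exact: mem_eigsp_monomial.
pose Z := [set i | `[< forall v, v \in E -> v i 0 = 0 >]].
have ZP i : i \in Z <-> forall v, v \in E -> v i 0 = 0.
  by rewrite inE; split=> /asboolP.
have Zsigma i : (sigma i \in Z) <-> (i \in Z).
  split=> /ZP h; apply/ZP => v vE; have := h v vE; have := iffLR (EP v) vE i.
    by move=> + e; rewrite e mulr0 => /esym/eqP; rewrite mulf_eq0 (negbTE z0) => /eqP.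
  by move=> + e; rewrite e mulr0 => /eqP; rewrite mulf_eq0 (negbTE (c0 i)) => /eqP.
have ratio i j : j \in porbit sigma i ->
    exists t : 'I_s, forall v, v \in E -> v j 0 = w ^+ t * v i 0.
  case/porbitP => k ->; elim: k => [|k [t ht]].
    exists (Ordinal (prim_order_gt0 hw)) => v _.
    by rewrite expg0 perm1 expr0 mul1r.
  have rs : (zeta / c ((sigma ^+ k)%g i)) ^+ s = 1.
    by rewrite exprMn exprVn zs cs invr1 mulr1.
  have [t' ht'] := prim_rootP hw rs.
  exists (Ordinal (ltn_pmod (t' + t) (prim_order_gt0 hw))) => v vE /=.
  rewrite (prim_expr_mod hw) exprD -ht' -mulrA -ht// expgSr permM.
  by apply: (mulfI (c0 ((sigma ^+ k)%g i))); rewrite (iffLR (EP v) vE) mulrA mulrCA divff ?mulr1.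
(* The representative is picked from the orbit as a set, so all points of one orbit share it; the
   default [i] only serves an empty [A]. *)
pose rep (A : {set 'I_n}) i := odflt i [pick j in A].
have repP i : i \in porbit sigma (rep (porbit sigma i) i).
  rewrite /rep; case: pickP => [j /=|_]; last exact: porbit_id.
  by rewrite porbit_sym.
have rep_eq i j : porbit sigma i = porbit sigma j ->
    rep (porbit sigma i) i = rep (porbit sigma j) j.
  move=> ->; rewrite /rep; case: pickP => // /(_ j).
  by rewrite porbit_id.
have /choice[l hl] : forall i, exists t : 'I_s, forall v, v \in E ->
   v i 0 = w ^+ t * v (rep (porbit sigma i) i) 0 by move=> i; apply: ratio.
have [x [xZ xl xb]] := @prepart_exists n s _ Z (porbit sigma) [ffun i => l i].
have xl' i : label x i = l i by rewrite xl ffunE.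
have subE v : v \in E -> v \in prepart_space w x.
  move=> vE; have v0 a : blk x a = set0 -> v a 0 = 0.
    by move=> /eqP; rewrite blk_eq0 xZ => /ZP; apply.
  apply/mem_prepart_space; split=> // a b e.
  have [/eqP a0|a0] := boolP (blk x a == set0); first by rewrite !v0 -?e// !mulr0.
  have b0 := a0; rewrite e in b0; rewrite !blk_eq0 xZ in a0 b0.
  rewrite !xl' (hl a)// (hl b)// mulrCA.
  by rewrite (rep_eq a b)//; apply/xb.
exists x; apply/vspaceP => v; apply/idP/idP => [|/subE//].
move=> /mem_prepart_space [v0 vb]; apply/EP => i.
have [iZ|iZ] := boolP (i \in Z).
  have siZ := iffRL (Zsigma i) iZ.
  by rewrite !v0 ?mulr0//; apply/eqP; rewrite blk_eq0 xZ.
have siZ : sigma i \notin Z by apply/negP => /Zsigma; apply/negP.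
have ib : blk x i = blk x (sigma i).
  apply/xb => //; apply/eqP; rewrite eq_porbit_mem porbit_sym.
  by rewrite -{1}[sigma]expg1 mem_porbit.
(* Off [Z] some eigenvector [u] does not vanish at [i]. Comparing [v] with [u] turns the label
   relation between [i] and [sigma i] into the eigenvector equation. *)
have [u uE ui] : exists2 u, u \in E & u i 0 != 0.
  apply: contrapT => h; move/negP: iZ; apply; apply/ZP => u uE.
  by apply: contrapT => /eqP ui; apply: h; exists u.
have /mem_prepart_space [_ /(_ _ _ ib) ub] := subE _ uE.
have cu := iffLR (EP u) uE i; have {}vb := vb _ _ ib.
apply: (mulfI (expf_neq0 (label x i) (prim_neq0 hw))); apply: (mulfI ui).
rewrite (mulrCA _ (c i)) -vb.
have ac (p q r t : C) : p * (q * (r * t)) = q * (r * p) * t by ring.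
by rewrite ac ub mulrCA cu -ac.
Qed.

End EigenspaceToPrepart.

(** * Residues of labels, products of weights and necessary conditions *)

Lemma equidistributed_card (T : finType) (B : {set T}) (f : T -> nat) (d : nat) :
  (0 < d)%N ->
  (forall j j', #|[set a in B | f a == j %[mod d]]%N| =
                #|[set a in B | f a == j' %[mod d]]%N|) ->
  #|B| = (d * #|[set a in B | f a == 0 %[mod d]]%N|)%N.
Proof.
move=> d0 h; rewrite -sum1_card.
rewrite (partition_big (fun a => Ordinal (ltn_pmod (f a) d0)) predT) //=.
rewrite -[X in (X * _)%N]card_ord -sum_nat_const; apply: eq_bigr => j _.
rewrite (h 0%N j) -sum1_card; apply: eq_bigl => a; rewrite !inE -val_eqE /=.
by rewrite (modn_small (ltn_ord j)).
Qed.

Section Arithmetic.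
Variables (C : fieldType) (s r d m : nat) (w zeta : C).
Hypothesis hw : s.-primitive_root w.
Hypothesis hzeta : m.-primitive_root zeta.
Hypotheses (hr : (0 < r)%N) (hd : d = (m %/ gcdn m r)%N) (hs : s = (d * r)%N).

Let g_gt0 : (0 < gcdn m r)%N. Proof. by rewrite gcdn_gt0 hr orbT. Qed.
Let mE : m = (d * gcdn m r)%N. Proof. by rewrite hd divnK ?dvdn_gcdl. Qed.

Lemma order_quotient_gt0 : (0 < d)%N.
Proof. by have := prim_order_gt0 hzeta; rewrite mE muln_gt0 => /andP[]. Qed.

(** [d] is the order of [zeta] modulo the [r]-th roots of unity: [m] divides [k * r] exactly when
    [d] divides [k], as [d] is prime to [r / gcd(m, r)]. *)
Lemma order_quotient_dvd k : (d %| k)%N = (zeta ^+ k ^+ r == 1).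
Proof.
rewrite -exprM -(prim_order_dvd hzeta) mE.
rewrite -[X in (_ %| k * X)%N](divnK (dvdn_gcdr m r)) mulnA dvdn_pmul2r//.
rewrite Gauss_dvdl// hd /coprime.
by rewrite -(eqn_pmul2r g_gt0) muln_gcdl mul1n !divnK ?dvdn_gcdl ?dvdn_gcdr.
Qed.

Lemma unity_lift (t : C) : t ^+ r = 1 -> t ^+ s = 1.
Proof. by move=> tr; rewrite hs mulnC exprM tr expr1n. Qed.

Lemma zeta_unity : zeta ^+ s = 1.
Proof. by apply/eqP; rewrite hs exprM -order_quotient_dvd. Qed.

(** With [q = gcd(z, d)], the power [zeta ^+ (d / q)] is already an [r]-th root of unity, so [d]
    divides [d / q] and [q = 1]. *)
Lemma zeta_log : exists2 z, zeta = w ^+ z & coprime z d.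
Proof.
have [[z _] /= zE] := prim_rootP hw zeta_unity; exists z => //.
have := order_quotient_gt0; have := dvdn_gcdr z d; set q := gcdn z d => qd d0.
have q0 : (0 < q)%N by rewrite gcdn_gt0 d0 orbT.
have : (d %| d %/ q)%N.
  rewrite order_quotient_dvd zE -!exprM.
  rewrite -(prim_order_dvd hw) hs -{1}(divnK qd) -[in X in (_ %| X)%N](divnK (dvdn_gcdl z d)).
  by apply/dvdnP; exists (z %/ q)%N; rewrite -/q; lia.
move=> /dvdn_leq; rewrite divn_gt0// dvdn_leq// => /(_ isT) le.
rewrite /coprime -/q eqn_leq q0 andbT leqNgt; apply/negP => q1.
by have := ltn_Pdiv q1 d0; rewrite ltnNge le.
Qed.

(** The [r]-th roots of unity are the powers of [w ^+ d], so multiplying by a weight does not change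
    exponents of [w] mod [d]. *)
Lemma unity_log (t : C) : t ^+ r = 1 -> exists k, t = w ^+ (d * k).
Proof.
move=> tr; have rs : (r %| s)%N by rewrite hs dvdn_mull.
have [k ->] := prim_rootP (dvdn_prim_root hw rs) tr.
by rewrite hs mulnK//; exists k; rewrite exprM.
Qed.

Section Eigenspaces.
Variables (n : nat) (sigma : {perm 'I_n}) (c : 'I_n -> C) (x : prepart n s).
Hypothesis cr : forall i, c i ^+ r = 1.
Hypothesis xE : prepart_space w x = eigsp (monomial_mx sigma c) zeta.
Local Notation Z := (zero_block x).

Let c0 i : c i != 0. Proof. by apply: (unity_neq0 hw); apply: unity_lift. Qed.

(** This is the [i]-th coordinate of the eigenvector equation for the block vector of [i]; its right
    side is nonzero, so [sigma i] stays in the block. *)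
Lemma eigen_step i : i \notin Z ->
  sigma i \in blk x i /\ c i * w ^+ label x (sigma i) = zeta * w ^+ label x i.
Proof.
move=> iZ; have := block_vector_in w x i.
rewrite xE => /mem_eigsp_monomial /(_ i); rewrite !mxE mem_blk iZ.
case: ifP => // _ /esym/eqP.
by rewrite mulr0 mulf_eq0 (negbTE (unity_neq0 hw zeta_unity)) expf_eq0 (negbTE (prim_neq0 hw)) andbF.
Qed.

Lemma eigen_stable i : (sigma i \in Z) = (i \in Z).
Proof.
have st j : j \in ~: Z -> sigma j \in ~: Z.
  rewrite !inE => jZ; have [h _] := eigen_step jZ.
  by rewrite -mem_blk (blk_same h).
have e : sigma @: (~: Z) = ~: Z.
  apply/eqP; rewrite eqEcard card_imset ?leqnn ?andbT//; last exact: perm_inj.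
  by apply/fintype.subsetP => _ /imsetP[j jZ ->]; apply: st.
apply/negb_inj; rewrite -!in_setC -{1}e.
by apply/imsetP/idP => [[j jZ /perm_inj->]|iZ]; last by exists i.
Qed.

(** Multiply the relations of [eigen_step] over the complement of the zero block; [sigma] permutes
    it, so the label factors cancel. *)
Lemma eigen_prod : \prod_(i in ~: Z) c i = zeta ^+ (n - #|Z|).
Proof.
have e : \prod_(i in ~: Z) (c i * w ^+ label x (sigma i)) =
         \prod_(i in ~: Z) (zeta * w ^+ label x i).
  by apply: eq_bigr => i; rewrite inE => /eigen_step[].
have ew : \prod_(i in ~: Z) w ^+ label x (sigma i) = \prod_(i in ~: Z) w ^+ label x i.
  rewrite [RHS](reindex_inj (@perm_inj _ sigma)) /=.
  by apply: eq_bigl => i; rewrite !inE eigen_stable.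
move: e; rewrite !big_split /= ew prodr_const cardsCs setCK card_ord.
by move/mulIf; apply; apply/prodf_neq0 => i _; rewrite expf_neq0 ?(prim_neq0 hw).
Qed.

Lemma eigen_zero_block0 : Z = set0 -> \prod_i c i = zeta ^+ n.
Proof.
move=> Z0; have := eigen_prod; rewrite Z0 cards0 subn0 => <-.
by apply: eq_bigl => i; rewrite !inE.
Qed.

(** If the zero block were a single point, [sigma] would fix it and the product condition would
    force its weight to be [zeta]. The corresponding basis vector would then be an eigenvector, yet
    it is nonzero on the zero block. *)
Lemma eigen_zero_block1 : \prod_i c i = zeta ^+ n -> #|Z| != 1%N.
Proof.
move=> h; apply/negP => /cards1P[i0 Z1].
have := eigen_prod; rewrite Z1 cards1 => hp.
have n0 : (0 < n)%N by exact: leq_ltn_trans (ltn_ord i0).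
have ci : c i0 = zeta.
  move: h; rewrite (bigD1 i0)//= -[in RHS](prednK n0) -subn1 exprS -hp.
  under [X in _ * X = _]eq_bigl do rewrite -in_setC1.
  move/mulIf; apply; exact/prodf_neq0.
have si : sigma i0 = i0 by apply/eqP; rewrite -in_set1 -Z1 eigen_stable Z1 inE.
have : \col_i (i == i0)%:R \in prepart_space w x.
  rewrite xE; apply/mem_eigsp_monomial => i; rewrite !mxE.
  have [->|ii] := eqVneq i i0; first by rewrite si eqxx ci.
  by rewrite -[X in sigma i == X]si (inj_eq perm_inj) (negbTE ii) !mulr0.
move=> /mem_prepart_space[/(_ i0) + _]; rewrite mxE eqxx => h0.
have /h0/eqP : blk x i0 = set0 by apply/eqP; rewrite blk_eq0 Z1 inE.
by rewrite oner_eq0.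
Qed.

(** [sigma] injects the class of residue [j] into that of [j + z]. As [z] is a unit mod [d], every
    residue is reached from every other, so all the inequalities between cardinals are
    equalities. *)
Lemma eigen_equidistributed B : B \in nonzero_blocks x ->
  (d %| #|B|)%N /\ forall j j' : nat,
    #|[set a in B | label x a == j %[mod d]]%N| =
    #|[set a in B | label x a == j' %[mod d]]%N|.
Proof.
move=> BP; have [z zE zd] := zeta_log.
have lstep a : a \in B -> sigma a \in B /\
    (label x (sigma a) = label x a + z %[mod d])%N.
  move=> aB; have aZ := nonzero_blocks_notin BP aB.
  have [h] := eigen_step aZ; rewrite (blk_def BP aB) in h.
  have [k ->] := unity_log (cr a); rewrite zE -!exprD => /(eqmod_prim hw) e.
  split=> //; move: e => /(congr1 (modn^~ d)).
  by rewrite !modn_dvdm ?hs ?dvdn_mulr// mulnC modnMDl addnC.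
have le_step j k : (#|[set a in B | label x a == j %[mod d]]%N| <=
    #|[set a in B | label x a == j + k * z %[mod d]]%N|)%N.
  elim: k => [|k IH]; first by rewrite mul0n addn0.
  apply: leq_trans IH _; rewrite -(card_imset _ (@perm_inj _ sigma)).
  apply/subset_leq_card/fintype.subsetP => _ /imsetP[a + ->].
  rewrite !inE => /andP[/lstep[sB ->] /eqP e]; rewrite sB /=.
  by rewrite -modnDml e modnDml mulSn addnCA addnC.
have d0 := order_quotient_gt0.
have le j j' : (#|[set a in B | label x a == j %[mod d]]%N| <=
    #|[set a in B | label x a == j' %[mod d]]%N|)%N.
  have [a _] := Bezoutl z d0; rewrite gcdnC (eqP zd) => /dvdnP[t at1].
  (* Here [a * z] is [-1] and [d.-1 * j'] is [- j'] mod [d], so this number of steps by [z] leads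
     from [j] to [j']. *)
  have -> : (j' = j + a * (j + d.-1 * j') * z %[mod d])%N.
    apply/modn_eq_dvdz; rewrite -[X in (X %| _)%Z]mul1r.
    apply/dvdzP; exists (j'%:Z - t%:Z * (j + d.-1 * j')%N%:Z).
    have {}at1 : 1 + a%:Z * z%:Z = t%:Z * d%:Z by rewrite -!PoszM -at1 PoszD.
    have ed : d.-1%:Z = d%:Z - 1 by rewrite -[in RHS](prednK d0) -addn1 PoszD addrK.
    have -> : (j + a * (j + d.-1 * j') * z)%N%:Z =
        j%:Z + (j + d.-1 * j')%N%:Z * (a%:Z * z%:Z).
      by rewrite PoszD !PoszM; ring.
    by rewrite -[a%:Z * z%:Z](addKr 1) at1 mul1r PoszD PoszM ed; ring.
  exact: le_step.
have eq_card j j' : #|[set a in B | label x a == j %[mod d]]%N| =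
    #|[set a in B | label x a == j' %[mod d]]%N|.
  by apply/eqP; rewrite eqn_leq !le.
by split=> //; rewrite (equidistributed_card d0 eq_card) dvdn_mulr.
Qed.

End Eigenspaces.
End Arithmetic.

(** * Realizing a prepartition by a monomial matrix *)

(** List [B] by taking the residues [0, z, 2z, ...] in turn, each time using the next element of the
    class; the permutation moves each element to the next one, cyclically. *)
Lemma cyclic_perm_exists (T : finType) (B : {set T}) (f : T -> nat) (d z : nat) :
  (0 < d)%N -> coprime z d ->
  (forall j j', #|[set a in B | f a == j %[mod d]]%N| =
                #|[set a in B | f a == j' %[mod d]]%N|) ->
  exists tau : {perm T}, [/\ forall a, a \in B -> tau a \in B,
    forall a b, a \in B -> b \in B -> exists k, b = iter k tau a &
    forall a, a \in B -> f (tau a) = f a + z %[mod d]].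
Proof.
move=> d0 zd eqB; have cB := equidistributed_card d0 eqB.
have [->|/set0Pn[b0 b0B]] := eqVneq B set0.
  by exists 1%g; split=> [a|a b|a]; rewrite inE.
set N := (X in (d * X)%N) in cB.
pose D k := [set a in B | f a == k * z %[mod d]]%N.
have DN k : size (enum (D k)) = N by rewrite -cardE; apply: eqB.
(* Entry [k] has residue [k * z] and is number [k %/ d] in its class; each of the [d] classes is
   visited [N] times. *)
pose g k := nth b0 (enum (D k)) (k %/ d).
have gD k : (k < #|B|)%N -> (g k \in B) && (f (g k) == k * z %[mod d])%N.
  move=> kl; have : g k \in D k by rewrite -mem_enum mem_nth// DN ltn_divLR// mulnC -cB.
  by rewrite inE.
have Up : uniq (mkseq g #|B|).
  apply/mkseq_uniqP => k k'; rewrite !inE => kl kl' e.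
  have /andP[_ /eqP h] := gD _ kl; have /andP[_ /eqP h'] := gD _ kl'.
  rewrite e h' in h.
  have kk : (k = k' %[mod d])%N.
    move/modn_eq_dvdz: h => h; apply/modn_eq_dvdz.
    rewrite -(@Gauss_dvdzl _ _ z) ?coprimezE 1?coprime_sym// mulrBl -!PoszM.
    by rewrite -opprB rpredN.
  have DD : D k = D k'.
    by apply/setP => a; rewrite !inE -modnMml kk modnMml.
  move: e; rewrite /g DD => /eqP; rewrite nth_uniq ?enum_uniq//; last 2 first.
  - by rewrite DN ltn_divLR// mulnC -cB.
  - by rewrite DN ltn_divLR// mulnC -cB.
  by move=> /eqP e; rewrite (divn_eq k d) (divn_eq k' d) e kk.
have pB : mkseq g #|B| =i B.
  have sub : {subset mkseq g #|B| <= enum B}.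
    by move=> _ /mapP[k + ->]; rewrite mem_iota mem_enum => /gD/andP[].
  have [|_ h] := uniq_min_size Up sub; first by rewrite -cardE size_mkseq.
  by move=> a; rewrite h mem_enum.
have cyc : cycle (fun a b => f b == f a + z %[mod d])%N (mkseq g #|B|).
  have B0 : (0 < #|B|)%N by apply/card_gt0P; exists b0.
  have fg k : (k < #|B|)%N -> f (g k) = k * z %[mod d] by move/gD/andP => [_ /eqP].
  rewrite -{1}(prednK B0) /mkseq /=; set q := rcons _ _.
  (* The last entry of [q] is [g 0] again; the formula persists there because [d] divides [#|B|],
     which is what closes the cycle. *)
  have fq i : (i < #|B|)%N -> f (nth b0 q i) = i.+1 * z %[mod d].
    move=> il; rewrite nth_rcons size_map size_iota.
    have [il'|il'] := ltnP i #|B|.-1.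
      by rewrite (nth_map 0%N) ?size_iota// nth_iota// fg// -ltn_predRL.
    have ei : i = #|B|.-1 by apply/eqP; rewrite eqn_leq il' -ltnS prednK// il.
    by rewrite ei eqxx prednK// fg// mul0n {1}cB -mulnA modnMr mod0n.
  apply/(pathP b0) => -[|i]; rewrite size_rcons size_map size_iota prednK// => il /=.
    by rewrite fq// -modnDml fg// modnDml mul0n add0n mul1n.
  by rewrite fq// -[X in _ == X]modnDml fq 1?ltnW// modnDml mulSn addnC.
exists (perm (can_inj (prev_next Up))); split=> [a|a b aB bB|a aB].
- by rewrite permE -!pB mem_next.
- rewrite -pB in aB; have := fconnect_cycle (cycle_next Up) aB b.
  rewrite pB bB => /iter_findex <-; exists (findex (next (mkseq g #|B|)) a b).
  by apply: eq_iter => c; rewrite permE.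
by rewrite permE; apply/eqP; apply: (next_cycle cyc); rewrite pB.
Qed.

Section PrepartToEigenspace.
Variables (C : fieldType) (n s r d m : nat) (w zeta : C).
Hypothesis hw : s.-primitive_root w.
Hypothesis hzeta : m.-primitive_root zeta.
Hypotheses (hr : (0 < r)%N) (hd : d = (m %/ gcdn m r)%N) (hs : s = (d * r)%N).
Variables (x : prepart n s) (PI : {set {set 'I_n}}) (K : {set 'I_n} -> C).
Hypothesis xeq : forall B, B \in nonzero_blocks x -> forall j j' : nat,
    #|[set a in B | label x a == j %[mod d]]%N| =
    #|[set a in B | label x a == j' %[mod d]]%N|.
Hypothesis PIp : partition PI (zero_block x).
Hypothesis Kr : forall B, B \in PI -> K B ^+ r = 1.
Hypothesis Kz : forall B, B \in PI -> K B != zeta ^+ #|B|.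
Local Notation Z := (zero_block x).

(** The permutation is one cycle on each nonzero block and on each block of [PI]. On nonzero blocks
    the weights are forced by the labels; on a block [B] of [PI] their product [K B] differs from
    [zeta ^+ #|B|], which kills all eigenvectors there. *)
Lemma prepart_eigenspace : exists sigma c,
  [/\ prepart_space w x = eigsp (monomial_mx sigma c) zeta,
      forall i, c i ^+ r = 1 &
      \prod_i c i = (\prod_(B in PI) K B) * zeta ^+ (n - #|Z|)].
Proof.
have [z zE zd] := zeta_log hw hzeta hr hd hs.
have d0 := order_quotient_gt0 hzeta hd.
have w0 i : w ^+ i != 0 by rewrite expf_neq0 ?(prim_neq0 hw).
pose bk a := if a \in Z then pblock PI a else blk x a.
have coverPI : cover PI = Z := cover_partition PIp.
have bkPI a : a \in Z -> bk a \in PI.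
  by move=> aZ; rewrite /bk aZ pblock_mem// coverPI.
have bkx a : a \notin Z -> bk a \in nonzero_blocks x.
  by move=> aZ; rewrite /bk (negbTE aZ) blk_mem.
have bk_mem a : a \in bk a.
  by rewrite /bk; case: ifP => aZ; [rewrite mem_pblock coverPI|rewrite mem_blk aZ].
have PIZ B a : B \in PI -> a \in B -> a \in Z.
  by move=> BP aB; rewrite -coverPI; apply/bigcupP; exists B.
have bk_PI B a : B \in PI -> a \in B -> bk a = B.
  move=> BP aB; rewrite /bk (PIZ B)//; apply: def_pblock => //.
  exact: partition_trivIset PIp.
have bk_x B a : B \in nonzero_blocks x -> a \in B -> bk a = B.
  by move=> BP aB; rewrite /bk (negbTE (nonzero_blocks_notin BP aB)) (blk_def BP).
have bk_same a b : b \in bk a -> bk b = bk a.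
  by have [/bkPI|/bkx] := boolP (a \in Z); [apply: bk_PI|apply: bk_x].
have bkZ a b : b \in bk a -> (b \in Z) = (a \in Z).
  have [aZ ba|aZ ba] := boolP (a \in Z); first exact: PIZ (bkPI _ aZ) ba.
  by apply/negbTE/(nonzero_blocks_notin (bkx _ aZ)).
have /choice[tau htau] : forall B : {set 'I_n}, exists tau : {perm 'I_n},
  [/\ forall a, a \in B -> tau a \in B,
    forall a b, a \in B -> b \in B -> exists k, b = iter k tau a &
    B \in nonzero_blocks x ->
    forall a, a \in B -> (label x (tau a) = label x a + z %[mod d])%N].
  move=> B; have [BP|BP] := boolP (B \in nonzero_blocks x).
    have [t [h1 h2 h3]] := cyclic_perm_exists d0 zd (xeq BP).
    by exists t; split.
  (* On the other sets any cyclic permutation will do: modulus 1 and a constant function make the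
     equidistribution hypothesis trivial. *)
  have eq1 (j j' : nat) : #|[set a in B | 0 == j %[mod 1]]%N| =
      #|[set a in B | 0 == j' %[mod 1]]%N|.
    by apply: eq_card => a; rewrite !inE !modn1.
  have [t [h1 h2 _]] := @cyclic_perm_exists _ B (fun=> 0%N) 1 0 isT isT eq1.
  by exists t; split=> // h; rewrite h in BP.
have tau_mem a : tau (bk a) a \in bk a by have [+ _ _] := htau (bk a); apply.
have sinj : injective (fun a => tau (bk a) a).
  move=> a b e; have ab : bk a = bk b.
    by rewrite -(bk_same _ _ (tau_mem a)) -(bk_same _ _ (tau_mem b)) e.
  by move: e; rewrite ab => /perm_inj.
pose sigma := perm sinj.
have bks a : bk (sigma a) = bk a by rewrite permE; apply: bk_same.
have sZ a : (sigma a \in Z) = (a \in Z) by apply: bkZ; rewrite permE.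
(* In the zero block the whole weight [K] of a cycle sits at one picked point, and all its other
   weights are 1. *)
pose c a := if a \in Z then
    (if [pick j in bk a] == Some a then K (bk a) else 1)
  else zeta * w ^+ label x a / w ^+ label x (sigma a).
have cZ B : B \in PI -> \prod_(i in B) c i = K B.
  move=> BP; have : exists j0, [pick j in B] = Some j0 /\ j0 \in B.
    have /set0Pn[j jB] := partition_neq0 PIp BP.
    by case: pickP => [j0 j0B|/(_ j)]; [exists j0|rewrite jB].
  move=> [j0 [pj j0B]]; rewrite (bigD1 j0)//= big1 ?mulr1.
    by rewrite /c (PIZ B)// (bk_PI B)// pj eqxx.
  move=> i /andP[iB ij]; rewrite /c (PIZ B)// (bk_PI B)// pj.
  by case: eqP => // -[e]; rewrite e eqxx in ij.
have cr i : c i ^+ r = 1.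
  rewrite /c; have [iZ|iZ] := boolP (i \in Z).
    by case: ifP => _; rewrite ?expr1n// Kr// bkPI.
  (* Labels move by [z] mod [d] along the cycle, so after raising to the power [r] the exponents of
     [w] agree mod [d * r]. *)
  have [_ _ /(_ (bkx _ iZ) i (bk_mem i)) h] := htau (bk i).
  apply: (mulIf (expf_neq0 r (w0 (label x (sigma i))))).
  rewrite -exprMn divfK//; rewrite mul1r zE -exprD -!exprM.
  apply/(eqmod_prim hw); rewrite [X in (_ = _ %[mod X])%N]hs -!muln_modl permE.
  by rewrite h addnC.
have xE : prepart_space w x = eigsp (monomial_mx sigma c) zeta.
  apply/vspaceP => v; apply/idP/idP.
    move=> /mem_prepart_space[v0 vb]; apply/mem_eigsp_monomial => i.
    have [iZ|iZ] := boolP (i \in Z).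
      by rewrite !v0 ?mulr0//; apply/eqP; rewrite blk_eq0 ?sZ.
    have e : blk x i = blk x (sigma i).
      by have := bks i; rewrite /bk sZ (negbTE iZ).
    rewrite /c (negbTE iZ); apply: (mulfI (w0 (label x (sigma i)))).
    rewrite mulrA [w ^+ _ * (_ / _)]mulrC divfK// -mulrA vb//.
    by rewrite mulrCA.
  move=> /mem_eigsp_monomial h; apply/mem_prepart_space.
  have v0 a : a \in Z -> v a 0 = 0.
    move=> aZ; apply/eqP; rewrite -[_ == _]negbK; apply/negP => va.
    have c0 b : c b != 0 by apply: (unity_neq0 hw); apply: unity_lift hs _ _.
    have [mt tr _] := htau (bk a).
    have nz b : b \in bk a -> v b 0 != 0.
      move=> /(tr _ _ (bk_mem a))[k ->]; elim: k => //= k IH.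
      set b' := iter k _ a in IH *.
      have b'a : b' \in bk a by rewrite /b'; elim: (k) => //= ? /mt.
      have := h b'; rewrite permE (bk_same _ _ b'a) => e.
      apply/eqP => e0; move: e; rewrite e0 mulr0 => /esym/eqP.
      by rewrite mulf_eq0 (negbTE IH) orbF (negbTE (unity_neq0 hw (zeta_unity hzeta hr hd hs))).
    (* A coordinate nonzero at [a] is nonzero along the whole cycle; multiplying the eigenvector
       equations around it gives [K B = zeta ^+ #|B|], which is excluded. *)
    have := Kz (bkPI _ aZ); apply/negP; rewrite negbK; apply/eqP.
    rewrite -(cZ _ (bkPI _ aZ)) -prodr_const.
    have pv : \prod_(i in bk a) v (sigma i) 0 = \prod_(i in bk a) v i 0.
      rewrite [RHS](reindex_inj (@perm_inj _ sigma)) /=; apply: eq_bigl => i.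
      apply/idP/idP => [/bk_same e|/bk_same e]; last by rewrite -e bks.
      by rewrite -e -bks.
    apply: (mulIf (x := \prod_(i in bk a) v i 0)); first exact/prodf_neq0.
    by rewrite -{1}pv -!big_split; apply: eq_bigr => i _; apply: h.
  split=> [a /eqP|a b e]; first by rewrite blk_eq0 => /v0.
  have [aZ|aZ] := boolP (a \in Z).
    by rewrite !v0 ?mulr0// -blk_eq0 -?e blk_eq0.
  have bB : b \in blk x a by rewrite -blk_eqE// e.
  have ebk : bk a = blk x a by rewrite /bk (negbTE aZ).
  have [mt tr _] := htau (bk a); rewrite -ebk in bB.
  have [k ->] := tr a b (bk_mem a) bB; elim: k => //= k IH.
  set b' := iter k _ a in IH *.
  have b'a : b' \in bk a by rewrite /b'; elim: (k) => //= ? /mt.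
  have := h b'; rewrite /c (bkZ _ _ b'a) (negbTE aZ) permE (bk_same _ _ b'a) => e'.
  apply: (mulfI (w0 (label x b'))); rewrite mulrCA IH.
  have z0 : zeta != 0 := unity_neq0 hw (zeta_unity hzeta hr hd hs).
  have e2 : w ^+ label x b' * v (tau (bk a) b') 0 =
      w ^+ label x (tau (bk a) b') * v b' 0.
    apply: (mulfI z0); rewrite [RHS]mulrCA -e' [RHS]mulrA.
    by rewrite [w ^+ _ * (_ / _)]mulrC divfK// mulrA.
  by rewrite [RHS]mulrCA e2 mulrCA.
exists sigma, c; split=> //; rewrite (bigID (mem Z)) /=; congr (_ * _).
  by rewrite (set_partition_big PI PIp); apply: eq_bigr => B; apply: cZ.
rewrite -(eigen_prod hw hzeta hr hd hs xE); apply: eq_bigl => i.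
by rewrite inE.
Qed.

End PrepartToEigenspace.

(** * The partition lattice *)

Lemma eq_preim_partition (T : finType) (rT rT' : eqType) (f : T -> rT) (g : T -> rT')
    (D : {set T}) :
  (forall i j, f i = f j <-> g i = g j) -> preim_partition f D = preim_partition g D.
Proof.
move=> h; apply: eq_imset => i; apply/setP => j; rewrite !inE.
by congr (_ && _); apply/eqP/eqP => /h.
Qed.

Lemma refines_preim_partition n (rT rT' : eqType) (f : 'I_n -> rT) (g : 'I_n -> rT') :
  refines (preim_partition f [set: 'I_n]) (preim_partition g [set: 'I_n]) <->
  forall i j, f i = f j -> g i = g j.
Proof.
split=> [h i j fij|h _ /imsetP[i _ ->]].
  have [|_ /imsetP[k _ ->] /fintype.subsetP sub] := h [set k in [set: 'I_n] | f i == f k].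
    by apply/imsetP; exists i.
  have := sub i; have := sub j; rewrite !inE fij eqxx.
  by move=> /(_ isT)/eqP <- /(_ isT)/eqP <-.
exists [set k in [set: 'I_n] | g i == g k]; first by apply/imsetP; exists i.
by apply/fintype.subsetP => j; rewrite !inE => /eqP /h ->; rewrite eqxx.
Qed.

Section PartitionLattice.
Variable n : nat.
Implicit Types x y : prepart n 1.

(* The index [ord0] plays the role of an extra point lying in the zero block. *)
Definition zero_pointed_block x (i : 'I_n.+1) : {set 'I_n} :=
  if unlift ord0 i is Some a then blk x a else set0.

Definition pointed_partition x : {set {set 'I_n.+1}} :=
  preim_partition (zero_pointed_block x) setT.

(** Modulo 1 the labels impose nothing, and absorption into the zero block means joining the block
    of the extra point. *)
Lemma prepart1_le x y : prepart_le x y <->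
  forall i j, zero_pointed_block x i = zero_pointed_block x j ->
              zero_pointed_block y i = zero_pointed_block y j.
Proof.
rewrite /zero_pointed_block; split=> [[h0 h] i j|h].
  case: unliftP => [a|] _; case: unliftP => [b|] _ //; first by move/h => [].
    exact: h0.
  by move=> e; rewrite (h0 b).
split=> [a a0|a b ab]; first by have := h (lift ord0 a) ord0; rewrite liftK unlift_none; apply.
by have := h (lift ord0 a) (lift ord0 b); rewrite !liftK !modn1 => /(_ ab) ->.
Qed.

Lemma pointed_partition_le x y :
  prepart_le x y <-> refines (pointed_partition x) (pointed_partition y).
Proof. by rewrite refines_preim_partition prepart1_le. Qed.

Lemma pointed_partition_equiv x y :
  prepart_equiv x y <-> pointed_partition x = pointed_partition y.
Proof.
split=> [xy|e]; last first.
  by apply: prepart_le_anti; apply/pointed_partition_le; rewrite e => B BP; exists B.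
have yx : prepart_equiv y x by rewrite prepart_equiv_sym.
move: xy yx => /prepart_equiv_le/prepart1_le h /prepart_equiv_le/prepart1_le h'.
by apply: eq_preim_partition => i j; split; [apply: h|apply: h'].
Qed.

(** The zero block consists of the points sharing a block with [ord0]. *)
Lemma pointed_partition_surj (P : {set {set 'I_n.+1}}) :
  partition P [set: 'I_n.+1] -> exists x, pointed_partition x = P.
Proof.
move=> PP; pose key (a : 'I_n) := pblock P (lift ord0 a).
have [x [xZ _ xb]] := prepart_exists [set a | key a == pblock P ord0] key
  [ffun=> ord0 : 'I_1].
exists x; rewrite -[RHS](preim_partition_pblock PP); apply: eq_preim_partition.
have x0 a : blk x a = set0 <-> key a = pblock P ord0.
  split=> [/eqP|/eqP e]; first by rewrite blk_eq0 xZ inE => /eqP.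
  by apply/eqP; rewrite blk_eq0 xZ inE.
rewrite /zero_pointed_block => i j.
case: unliftP => [a ->|->]; case: unliftP => [b ->|->] //.
- have [/eqP a0|a0] := boolP (blk x a == set0).
    by rewrite a0 -/(key a) (iffLR (x0 a) a0); split=> /esym/x0/esym.
  have [/eqP b0|b0] := boolP (blk x b == set0).
    by rewrite b0 -/(key b) (iffLR (x0 b) b0); apply: x0.
  by apply: xb; rewrite -xZ -blk_eq0.
by split=> /esym/x0/esym.
Qed.

(** Makes the extra point an actual coordinate: [Q_n(1)] is embedded in [Q_(n+1)(1)] as the elements
    with empty zero block. *)
Definition pointed_prepart x : prepart n.+1 1 :=
  @Prepart n.+1 1 (set0, pointed_partition x, [ffun=> ord0])
    (etrans (congr1 (partition _) (setC0 _)) (preim_partitionP _ _)).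

Lemma blk_pointed_prepart x i j :
  blk (pointed_prepart x) i = blk (pointed_prepart x) j <->
  zero_pointed_block x i = zero_pointed_block x j.
Proof.
have eqk : {in [set: 'I_n.+1] & &,
    equivalence_rel (fun i j => zero_pointed_block x i == zero_pointed_block x j)}.
  by split=> // /eqP->.
have e : (j \in blk (pointed_prepart x) i) =
    (zero_pointed_block x i == zero_pointed_block x j).
  by apply: (pblock_equivalence_partition eqk); rewrite inE.
rewrite -blk_eqE ?inE// in e.
by split=> /eqP; [rewrite e|rewrite -e] => /eqP.
Qed.

Lemma pointed_prepart_le x y :
  prepart_le x y <-> prepart_le (pointed_prepart x) (pointed_prepart y).
Proof.
rewrite prepart1_le; split=> [h|[_ h] i j /blk_pointed_prepart/h[]/blk_pointed_prepart//].
split=> [i /eqP|i j /blk_pointed_prepart/h/blk_pointed_prepart -> ].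
  by rewrite blk_eq0 inE.
by rewrite !modn1.
Qed.

Lemma pointed_prepart_surj (x : prepart n.+1 1) : zero_block x = set0 ->
  exists y, prepart_equiv x (pointed_prepart y).
Proof.
move=> xZ; have := nonzero_blocksP x; rewrite xZ setC0 => /pointed_partition_surj[y yx].
exists y; apply/prepart_equivP; split=> // B _.
by exists 0%N => a _; rewrite !modn1.
Qed.

End PartitionLattice.

(** * Which prepartitions give eigenspaces of the coset *)

Lemma partition_set1 (T : finType) (A : {set T}) :
  A != set0 -> partition [set A] A.
Proof.
move=> A0; rewrite /partition /cover big_set1 eqxx inE eq_sym A0 andbT /=.
by apply/trivIsetP => B B'; rewrite !inE => /eqP-> /eqP->; rewrite eqxx.
Qed.

Section EigenspacePoset.
Variables (C : fieldType) (n s r p d m : nat) (w zeta x : C).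
Hypothesis hw : s.-primitive_root w.
Hypothesis hzeta : m.-primitive_root zeta.
Hypotheses (hr : (0 < r)%N) (hn : (0 < n)%N) (xr : x ^+ r = 1).
Hypotheses (hd : d = (m %/ gcdn m r)%N) (hs : s = (d * r)%N).

Local Notation Q := (dowling n s).
Local Notation S := (eigenspaces zeta (left_translate (diag1 n x) (@Grpn C n r p))).

Lemma eigenspacesP (E : {vspace 'cV[C]_n}) : S E <->
  exists sigma c, [/\ E = eigsp (monomial_mx sigma c) zeta,
    forall i, c i ^+ r = 1 & (\prod_i c i) ^+ (r %/ p) = x ^+ (r %/ p)].
Proof.
split=> [[M /(left_translateP _ _ hr hn xr)[sigma [c [-> cr cp]]] <-]|[sigma [c [-> cr cp]]]].
  by exists sigma, c.
by exists (monomial_mx sigma c) => //; apply/(left_translateP _ _ hr hn xr); exists sigma, c.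
Qed.

Lemma eigenspaces_prepart E : S E -> exists y : prepart n s, prepart_space w y = E.
Proof.
move=> /eigenspacesP[sigma [c [-> cr _]]]; apply: eigenspace_prepart => //.
  by move=> i; apply: (unity_lift hs (cr i)).
exact: zeta_unity hzeta hr hd hs.
Qed.

(** Reduces every case to deciding which classes have an eigenspace as attached subspace; the order
    is already settled by [dowling_leP]. *)
Lemma eigenspaces_iso (A : set Q) :
  (forall q, A q <-> S (dowling_space w q)) -> poset_iso S (@rev_incl C n) A dowling_le.
Proof.
move=> hA; have s0 := prim_order_gt0 hw.
have [x0 _] := prepart_exists finset.set0 (fun _ : 'I_n => tt) [ffun=> Ordinal s0].
apply: (poset_iso_of_inverse (\pi_Q x0)%qT (g := dowling_space w)) => [q /hA//|E||].
- move=> SE; have [y yE] := eigenspaces_prepart SE.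
  by exists (\pi_Q y)%qT; [apply/hA|]; rewrite (dowling_space_cls hw) yE.
- by move=> q q' _ _; apply: dowling_space_inj.
by move=> q q' _ _; apply: dowling_leP.
Qed.

Definition balanced (y : prepart n s) : Prop := forall B, B \in nonzero_blocks y ->
    (d %| #|B|)%N /\
    forall j j' : nat,
      #|[set a in B | label y a == j %[mod d]]%N| =
      #|[set a in B | label y a == j' %[mod d]]%N|.

Lemma eigenspaces_necessary (y : prepart n s) : S (prepart_space w y) ->
  [/\ balanced y,
    zero_block y = set0 -> zeta ^+ n ^+ (r %/ p) = x ^+ (r %/ p) &
    r = p -> zeta ^+ n = x -> #|zero_block y| != 1%N].
Proof.
move=> /eigenspacesP[sigma [c [yE cr cp]]]; split=> [B||rp zx].
- exact: (eigen_equidistributed hw hzeta hr hd hs cr yE).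
- by move=> /(eigen_zero_block0 hw hzeta hr hd hs yE) <-.
apply: (eigen_zero_block1 hw hzeta hr hd hs cr yE).
by move: cp; rewrite -rp divnn hr !expr1 zx.
Qed.

Lemma balanced_dvd (y : prepart n s) : balanced y -> (d %| n - #|zero_block y|)%N.
Proof.
move=> hy.
have -> : (n - #|zero_block y| = #|~: zero_block y|)%N by rewrite [RHS]cardsCs setCK card_ord.
rewrite (card_partition (nonzero_blocksP y)).
by apply: (big_ind (dvdn d)) => [|? ? |B /hy[]//]; [exact: dvdn0|exact: dvdn_add].
Qed.

Section Sufficient.
Variable y : prepart n s.
Hypothesis hy : balanced y.
Local Notation Z := (zero_block y).

Lemma eigenspaces_cycles (PI : {set {set 'I_n}}) (K : {set 'I_n} -> C) :
  partition PI Z -> (forall B, B \in PI -> K B ^+ r = 1) ->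
  (forall B, B \in PI -> K B != zeta ^+ #|B|) ->
  ((\prod_(B in PI) K B) * zeta ^+ (n - #|Z|)) ^+ (r %/ p) = x ^+ (r %/ p) ->
  S (prepart_space w y).
Proof.
move=> PIp Kr Kz Kp.
have [|sigma [c [yE cr cp]]] :=
  prepart_eigenspace hw hzeta hr hd hs _ PIp Kr Kz; first by move=> B /hy[].
by apply/eigenspacesP; exists sigma, c; split=> //; rewrite cp.
Qed.

Lemma eigenspaces_zero_block0 : Z = set0 ->
  zeta ^+ n ^+ (r %/ p) = x ^+ (r %/ p) -> S (prepart_space w y).
Proof.
move=> Z0 h; apply: (@eigenspaces_cycles set0 (fun=> 1)); rewrite ?Z0 ?partition_set0//.
- by move=> B; rewrite inE.
- by move=> B; rewrite inE.
by rewrite big_set0 mul1r cards0 subn0.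
Qed.

Lemma eigenspaces_one_cycle t : Z != set0 -> t ^+ r = 1 -> t != zeta ^+ #|Z| ->
  (t * zeta ^+ (n - #|Z|)) ^+ (r %/ p) = x ^+ (r %/ p) -> S (prepart_space w y).
Proof.
move=> Z0 tr tz tx; apply: (@eigenspaces_cycles [set Z] (fun=> t)).
- exact: partition_set1.
- by [].
- by move=> B; rewrite inE => /eqP->.
by rewrite big_set1.
Qed.

Let z0 : zeta != 0 := unity_neq0 hw (zeta_unity hzeta hr hd hs).

Let zr : (zeta ^+ (n - #|Z|)) ^+ r = 1.
Proof. by apply/eqP; rewrite -(order_quotient_dvd hzeta hr hd); apply: balanced_dvd. Qed.

Let zn : zeta ^+ #|Z| * zeta ^+ (n - #|Z|) = zeta ^+ n.
Proof. by rewrite -exprD subnKC// -[X in (_ <= X)%N]card_ord max_card. Qed.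

(** One cycle on [Z], with the weight that makes the total product equal to [x]; it differs from
    [zeta ^+ #|Z|] because [zeta ^+ n] differs from [x]. *)
Lemma eigenspaces_generic : Z != set0 -> zeta ^+ n != x -> S (prepart_space w y).
Proof.
move=> Z0 zx; apply: (@eigenspaces_one_cycle (x / zeta ^+ (n - #|Z|))) => //.
- by rewrite exprMn exprVn zr xr invr1 mulr1.
- apply: contra_neq zx => h.
  by rewrite -zn -h divfK// expf_neq0.
by rewrite divfK// expf_neq0.
Qed.

(** When [zeta ^+ n = x], a single cycle with total product [x] would have the forbidden weight
    [zeta ^+ #|Z|]. Split off a fixed point of weight [t] and give the rest [zeta ^+ #|Z| / t]; both
    avoid the forbidden values since [t] is not [zeta]. *)
Lemma eigenspaces_two_cycles t : (1 < #|Z|)%N -> zeta ^+ n = x ->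
  t ^+ r = 1 -> t != zeta -> S (prepart_space w y).
Proof.
move=> Z1 zx tr tz; have [i0 i0Z] : exists i0, i0 \in Z.
  by apply/card_gt0P; apply: ltnW.
have t0 : t != 0 by apply: contra_eq_neq tr => ->; rewrite expr0n (gtn_eqF hr) eq_sym oner_eq0.
have cD : #|Z| = #|Z :\ i0|.+1 by rewrite (cardsD1 i0) i0Z.
have D0 : Z :\ i0 != set0 by rewrite -card_gt0 -ltnS -cD.
have P1 : partition [set Z :\ i0] (Z :\ i0) by apply: partition_set1.
have ne : [set i0] != Z :\ i0.
  by apply/eqP => /setP/(_ i0); rewrite !inE eqxx.
pose t' := zeta ^+ #|Z| / t.
have zZr : zeta ^+ #|Z| ^+ r = 1.
  by have := congr1 (fun u => u ^+ r) zn; rewrite zx exprMn zr mulr1 xr.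
apply: (@eigenspaces_cycles ([set i0] |: [set Z :\ i0])
  (fun B => if B == [set i0] then t else t')).
- have := @partitionU1 _ _ _ [set i0] P1.
  rewrite setD1K//; apply; first by apply/set0Pn; exists i0; rewrite inE.
  by rewrite disjoints1 !inE eqxx.
- by move=> B _; case: ifP => // _; rewrite exprMn exprVn zZr tr invr1 mulr1.
- move=> B; rewrite !inE; case: ifP => [/eqP-> _|_ /= /eqP->]; first by rewrite cards1.
  apply: contra_neq tz => h; apply: (mulfI (expf_neq0 #|Z :\ i0| z0)).
  by rewrite -exprSr -cD -h divfK.
rewrite big_setU1 ?inE//= big_set1 eqxx eq_sym (negbTE ne).
by rewrite [t * _]mulrC divfK// zn zx.
Qed.

(** The coset condition only sees the product up to [(r / p)]-th roots of unity, so the forbidden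
    weight can be multiplied by [t]. *)
Lemma eigenspaces_root (t : C) : Z != set0 -> (r %/ p %| r)%N ->
  t ^+ (r %/ p) = 1 -> t != 1 -> S (prepart_space w y).
Proof.
move=> Z0 /divnK rp tp t1; have [zx|zx] := eqVneq (zeta ^+ n) x; last first.
  exact: eigenspaces_generic.
have zZr : zeta ^+ #|Z| ^+ r = 1.
  by have := congr1 (fun u => u ^+ r) zn; rewrite zx exprMn zr mulr1 xr.
have tr : t ^+ r = 1 by rewrite -rp mulnC exprM tp expr1n.
apply: (@eigenspaces_one_cycle (t * zeta ^+ #|Z|)) => //.
- by rewrite exprMn tr zZr mulr1.
- by rewrite -[X in _ != X]mul1r (inj_eq (mulIf _)) ?expf_neq0.
by rewrite -mulrA zn exprMn tp mul1r zx.
Qed.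

End Sufficient.
End EigenspacePoset.

(** * The case of permutation matrices *)

Section PartitionCase.
Variables (C : fieldType) (n : nat) (w : C).
Hypothesis hw : 1.-primitive_root w.
Local Notation Q := (dowling n 1).

Lemma dowling_prepart_le (q q' : Q) :
  dowling_le q q' <-> prepart_le (repr q) (repr q').
Proof. by rewrite (dowling_leP hw) (prepart_space_sub hw). Qed.

Lemma pointed_partition_iso :
  poset_iso (@classical_sets.setT Q) dowling_le (@partition_lattice n.+1) (@refines n.+1).
Proof.
exists (fun q : Q => pointed_partition (repr q)).
  split=> [q _|q q' _ _ /pointed_partition_equiv e|P /pointed_partition_surj[y yP]].
  - exact: preim_partitionP.
  - by rewrite -[q]reprK -[q']reprK; apply/eqmodP.
  exists (\pi_Q y)%qT => //; rewrite -yP; apply/pointed_partition_equiv.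
  by apply/eqmodP; rewrite reprK.
move=> q q' _ _ /=; apply: (iff_trans (dowling_prepart_le q q')).
exact: pointed_partition_le.
Qed.

(** For [r = 1] all weights are 1 and the all-ones vector is fixed, so zero blocks are empty and the
    prepartitions concerned are, up to equivalence, those of the form [pointed_prepart]. *)
Lemma fixed_space_iso :
  poset_iso (eigenspaces 1 (left_translate (diag1 n.+1 1) (@Grpn C n.+1 1 1)))
    (@rev_incl C n.+1) (@classical_sets.setT Q) dowling_le.
Proof.
have h1 : 1.-primitive_root (1 : C).
  by apply/andP; split=> //; apply/forallP => -[[|i] hi];
    rewrite ?unity_rootE ?expr1 ?eqxx.
have le (q q' : Q) : dowling_le q q' <-> (prepart_space w (pointed_prepart (repr q')) <=
    prepart_space w (pointed_prepart (repr q)))%VS.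
  by rewrite dowling_prepart_le pointed_prepart_le (prepart_space_sub hw).
have space_equiv (y y' : prepart n 1) : prepart_equiv y y' ->
    prepart_space w (pointed_prepart y) = prepart_space w (pointed_prepart y').
  move=> yy'; have y'y : prepart_equiv y' y by rewrite prepart_equiv_sym.
  apply: subv_anti; apply/andP.
  split; apply: (iffLR (prepart_space_sub hw _ _));
    apply: (iffLR (pointed_prepart_le _ _)); exact: prepart_equiv_le.
have bal (y : prepart n.+1 1) : balanced 1 y.
  by move=> B _; split=> // j j'; apply: eq_card => a; rewrite !inE !modn1.
have [x0 _] := prepart_exists finset.set0 (fun _ : 'I_n => tt) [ffun=> ord0 : 'I_1].
apply: (poset_iso_of_inverse (\pi_Q x0)%qT
  (g := fun q : Q => prepart_space w (pointed_prepart (repr q)))) => [q _|E SE|q q' _ _ e|q q' _ _].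
- apply: (eigenspaces_zero_block0 (d := 1) hw h1 _ _ (expr1n _ _) _ _ (bal _)) => //.
  by rewrite !expr1n.
- have [y yE] := eigenspaces_prepart (r := 1) (d := 1) hw h1 isT (ltn0Sn n) (expr1n _ _) erefl erefl SE.
  have yZ : zero_block y = set0.
    apply/setP => a; rewrite inE -blk_eq0; apply/negP => /eqP ya.
    move: SE => /(@eigenspacesP _ _ 1 1 1 1 isT (ltn0Sn n) (expr1n _ _))[sigma [c [Ec c1 _]]].
    have : const_mx 1 \in prepart_space w y.
      rewrite yE Ec; apply/mem_eigsp_monomial => i.
      by have := c1 i; rewrite expr1 => ->; rewrite !mxE.
    by move=> /mem_prepart_space[/(_ _ ya)/eqP]; rewrite mxE oner_eq0.
  have [y' yy'] := pointed_prepart_surj yZ.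
  exists (\pi_Q y')%qT => //.
  rewrite (space_equiv _ y'); last by apply/eqmodP; rewrite reprK.
  by rewrite -yE; apply: (prepart_space_equiv hw); rewrite prepart_equiv_sym.
- rewrite -[q]reprK -[q']reprK; apply/eqmodP.
  by apply: prepart_le_anti; apply/dowling_prepart_le; apply/le; rewrite e.
exact: le.
Qed.
End PartitionCase.

(** * The six cases *)

Local Open Scope classical_set_scope.
Local Open Scope ring_scope.
Local Open Scope complex_scope.

Theorem theorem3p19 (R : realType) (xi : nat -> R[i])
    (hxi : forall s : nat, (0 < s)%N -> s.-primitive_root (xi s))
    (r p n e : nat) (hr : (0 < r)%N) (hp : (0 < p)%N) (hn : (0 < n)%N)
    (he : (0 < e)%N) (hpr : (p %| r)%N) (hep : (e %| p)%N)
    (m : nat) (zeta : R[i]) (hzeta : m.-primitive_root zeta)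
    (d : nat) (hd : d = (m %/ gcdn m r)%N) :
  let x := xi ((e * r) %/ p)%N in
  let S := eigenspaces zeta (left_translate (diag1 n x) (@Grpn _ n r p)) in
  let cond := (zeta ^+ n * x^-1) ^+ (r %/ p)%N <> 1 in
  [/\ ((1 < d)%N -> n = 0 %[mod d] -> cond ->
        poset_iso S (@rev_incl _ n)
          (dowling_dkJ d d (pred1 0%N) `\` @dowling_bot n (d * r)) dowling_le),
      ((1 < d)%N -> ~ (n = 0 %[mod d] /\ cond) ->
        poset_iso S (@rev_incl _ n)
          (dowling_dk d d `\` @dowling_bot n (d * r)) dowling_le),
      (d = 1%N -> cond ->
        poset_iso S (@rev_incl _ n)
          (dowling_J (pred1 0%N) `\` @dowling_bot n r) dowling_le)
    & [/\ (d = 1%N -> r = p -> r <> 1%N -> zeta ^+ n = xi e ->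
            poset_iso S (@rev_incl _ n)
              (@dowling_J n r (pred1 1%N)) dowling_le),
          (d = 1%N -> r = p -> r = 1%N ->
            [/\ m = 1%N,
                poset_iso S (@rev_incl _ n)
                  [set: dowling n.-1 1] dowling_le
              & poset_iso [set: dowling n.-1 1] dowling_le
                  (@partition_lattice n) (@refines n)])
        & (d = 1%N -> ~ cond ->
            ~ (r = p /\ r <> 1%N /\ zeta ^+ n = xi e) ->
            ~ (r = p /\ r = 1%N) ->
            poset_iso S (@rev_incl _ n)
              [set: dowling n r] dowling_le)]].
Proof.
move=> x S cond.
have g0 : (0 < gcdn m r)%N by rewrite gcdn_gt0 hr orbT.
have d0 : (0 < d)%N := order_quotient_gt0 hzeta hd.
have rp0 : (0 < r %/ p)%N by rewrite divn_gt0// dvdn_leq.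
have xE : x = xi (e * (r %/ p))%N by rewrite /x muln_divA.
have xp : (e * (r %/ p)).-primitive_root x by rewrite xE hxi// muln_gt0 he.
have xr : x ^+ r = 1.
  apply/eqP; rewrite -(prim_order_dvd xp) -[X in (_ %| X)%N](divnK hpr) mulnC.
  exact: dvdn_mul.
have x0 : x != 0 by rewrite (prim_root_eq0 xp) -lt0n muln_gt0 he.
have condE : cond <-> zeta ^+ n ^+ (r %/ p) <> x ^+ (r %/ p).
  have xk : x ^+ (r %/ p) != 0 by rewrite expf_neq0.
  rewrite /cond exprMn exprVn; split=> h h'; apply: h; first by rewrite h' mulfV.
  by apply: (mulIf (invr_neq0 xk)); rewrite h' mulfV.
have cond_ne : cond -> zeta ^+ n != x.
  by move=> /condE h; apply/eqP => e1; apply: h; rewrite e1.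
have bot0 s (q : dowling n s) : dowling_bot q -> zero_block (repr q) = finset.set0.
  by case.
have card0 (A : {set 'I_n}) : (#|A| \in (pred1 0%N : pred nat)) = (A == finset.set0).
  by rewrite inE cards_eq0.
split.
- move=> d1 nd hc; pose s := (d * r)%N.
  have hw : s.-primitive_root (xi s) by rewrite hxi// muln_gt0 d0.
  apply: (eigenspaces_iso hw hzeta hr hn xr hd erefl) => q; split.
    move=> [[b|[hq +]] nb]; [by case: nb|rewrite /= card0 => Z0].
    have hy : balanced d (repr q) by case: hq => // /nb.
    exact: (eigenspaces_generic _ hw hzeta hr hn xr hd erefl hy Z0 (cond_ne hc)).
  move=> /(eigenspaces_necessary hw hzeta hr hn xr hd erefl)[hy hz _].
  have Z0 : zero_block (repr q) != finset.set0.
    by apply/eqP => /hz; apply/condE.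
  split; last by move=> /bot0/eqP; rewrite (negbTE Z0).
  by right; split; [right|rewrite /= card0].
- move=> d1 hc; pose s := (d * r)%N.
  have hw : s.-primitive_root (xi s) by rewrite hxi// muln_gt0 d0.
  apply: (eigenspaces_iso hw hzeta hr hn xr hd erefl) => q; split.
    move=> [[b|hy] nb]; [by case: nb|have dn := balanced_dvd hy].
    have [Z0|Z0] := eqVneq (zero_block (repr q)) finset.set0.
      apply: (eigenspaces_zero_block0 hw hzeta hr hn xr hd erefl hy Z0).
      (* An empty zero block forces [d] to divide [n], so it is [cond] that fails, and [zeta ^+ n]
         satisfies the coset condition. *)
      apply: contrapT => /condE hc'; apply: hc; split=> //.
      by move: dn; rewrite Z0 cards0 subn0 => /eqP ->; rewrite mod0n.
    have [zx|zx] := eqVneq (zeta ^+ n) x; last first.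
      exact: (eigenspaces_generic _ hw hzeta hr hn xr hd erefl hy Z0 zx).
    have dn' : (d %| n)%N by rewrite (order_quotient_dvd hzeta hr hd) zx xr.
    have Zn : (#|zero_block (repr q)| <= n)%N by rewrite -[X in (_ <= X)%N]card_ord max_card.
    apply: (eigenspaces_two_cycles _ hw hzeta hr hn xr hd erefl hy _ zx (expr1n _ _)).
    (* [d] divides both [n] and [n - #|Z|], so the nonempty zero block has at least [d > 1]
       points. *)
    + apply: leq_trans d1 _; apply: dvdn_leq; first by rewrite card_gt0.
      by rewrite -(dvdn_addr _ dn) subnK.
    apply: contraTneq d1 => z1; rewrite -leqNgt; apply: dvdn_leq => //.
    by rewrite (order_quotient_dvd hzeta hr hd) -z1 !expr1n.
  move=> /(eigenspaces_necessary hw hzeta hr hn xr hd erefl)[hy _ _].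
  split; first by right.
  (* The minimum is not attained: its blocks are singletons, while [d > 1] divides the size of every
     block. *)
  move=> [_ nz]; have : [set Ordinal hn]%SET \in nonzero_blocks (repr q).
    by rewrite nz; apply: imset_f.
  by move=> /hy[]; rewrite cards1 dvdn1 => /eqP d1'; rewrite d1' in d1.
- move=> d1 hc.
  have hs : r = (d * r)%N by rewrite d1 mul1n.
  have hw : r.-primitive_root (xi r) by rewrite hxi.
  apply: (eigenspaces_iso hw hzeta hr hn xr hd hs) => q; split.
    move=> [[b|+] nb]; [by case: nb|rewrite /= card0 => Z0].
    have hy : balanced d (repr q).
      by move=> B _; rewrite d1; split=> // j j'; apply: eq_card => a; rewrite !inE !modn1.
    exact: (eigenspaces_generic _ hw hzeta hr hn xr hd hs hy Z0 (cond_ne hc)).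
  move=> /(eigenspaces_necessary hw hzeta hr hn xr hd hs)[_ hz _].
  have Z0 : zero_block (repr q) != finset.set0.
    by apply/eqP => /hz; apply/condE.
  split; last by move=> /bot0/eqP; rewrite (negbTE Z0).
  by right; rewrite /= card0.
have bal1 (d1 : d = 1%N) s (y : prepart n s) : balanced d y.
  by move=> B _; rewrite d1; split=> // j j'; apply: eq_card => a; rewrite !inE !modn1.
have hw : r.-primitive_root (xi r) by rewrite hxi.
split.
- move=> d1 rp r1 zx'.
  have hs : r = (d * r)%N by rewrite d1 mul1n.
  have zx : zeta ^+ n = x by rewrite xE -rp divnn hr muln1.
  apply: (eigenspaces_iso hw hzeta hr hn xr hd hs) => q; split; last first.
    move=> /(eigenspaces_necessary hw hzeta hr hn xr hd hs)[_ _ hz].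
    by right; rewrite /= inE; apply: hz.
  move=> hq; have hy := bal1 d1 _ (repr q).
  have [Z0|Z0] := eqVneq (zero_block (repr q)) finset.set0.
    by apply: (eigenspaces_zero_block0 hw hzeta hr hn xr hd hs hy Z0); rewrite zx.
  have Z1 : (1 < #|zero_block (repr q)|)%N.
    rewrite ltn_neqAle eq_sym card_gt0 Z0 andbT.
    by case: hq => [/bot0 Z0'|]; [rewrite Z0' eqxx in Z0|rewrite /= inE].
  (* As [r] is not 1, at least one of the [r]-th roots of unity [1] and [xi r] differs from
     [zeta]. *)
  have [t tr tz] : exists2 t, t ^+ r = 1 & t != zeta.
    have [z1|z1] := eqVneq zeta 1; last by exists 1; rewrite ?expr1n 1?eq_sym.
    exists (xi r); first exact: prim_expr_order.
    rewrite z1; apply/eqP => t1; have := prim_order_dvd hw 1.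
    by rewrite expr1 t1 eqxx dvdn1 => /eqP.
  exact: (eigenspaces_two_cycles _ hw hzeta hr hn xr hd hs hy Z1 zx tr tz).
- move=> d1 rp r1; rewrite /S {S cond condE cond_ne}.
  have m1 : m = 1%N by move: hd; rewrite r1 gcdn1 divn1 d1.
  have z1 : zeta = 1 by have := prim_expr_order hzeta; rewrite m1 expr1.
  have -> : x = 1 by move: xr; rewrite r1 expr1.
  have p1 : p = 1%N by rewrite -rp.
  rewrite r1 p1 z1; split=> //.
    by clear -hn hxi; case: n hn => // n' _; apply: fixed_space_iso; apply: hxi.
  by clear -hn hxi; case: n hn => // n' _; apply: pointed_partition_iso; apply: hxi.
move=> d1 hc h4 h5.
have hs : r = (d * r)%N by rewrite d1 mul1n.
apply: (eigenspaces_iso hw hzeta hr hn xr hd hs) => q; split=> // _.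
have hy := bal1 d1 _ (repr q).
have hc' : zeta ^+ n ^+ (r %/ p) = x ^+ (r %/ p).
  by apply: contrapT => /condE.
have [Z0|Z0] := eqVneq (zero_block (repr q)) finset.set0.
  exact: (eigenspaces_zero_block0 hw hzeta hr hn xr hd hs hy Z0).
(* If [r = p], the coset condition reads [zeta ^+ n = xi e], and one of the two excluded cases
   applies. Hence [r / p > 1], and [xi (r / p)] is a nontrivial root with which to change the
   forbidden weight. *)
have rpn : r <> p.
  move=> rp; have rp1 : (r %/ p = 1)%N by rewrite -rp divnn hr.
  have [r1|r1] := eqVneq r 1%N; first exact: h5.
  by apply: h4; split=> //; split; [exact/eqP|rewrite -[e]muln1 -rp1 -xE -[x]expr1 -rp1 -hc' rp1].
have rpr : (r %/ p %| r)%N by rewrite -{2}(divnK hpr) dvdn_mulr.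
have tp := hxi _ rp0.
apply: (eigenspaces_root hw hzeta hr hn xr hd hs hy Z0 rpr (prim_expr_order tp)).
apply/eqP => t1; have := prim_order_dvd tp 1; rewrite expr1 t1 eqxx dvdn1 => /eqP rp1.
by apply: rpn; rewrite -[LHS](divnK hpr) rp1 mul1n.
Qed.
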